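(* Fix positive integers $h,g$ and $\Omega\in H_g$. Then $A(\Omega)$ has the direct sum decomposition $$A(\Omega)=\bigoplus_{J\in\mathbb Z^{(h,g)}_{\ge0}}\Delta^J T(\Omega)=\bigoplus_{J\in\mathbb Z^{(h,g)}_{\ge0}}\ \bigoplus_{\mathcal M\in\mathbb M(h)}\Delta^J T_{\mathcal M}(\Omega),$$ and for each $J\in\mathbb Z^{(h,g)}_{\ge0}$ and $\mathcal M\in\mathbb M(h)$, $\Delta^J$ induces a vector space isomorphism of $T_{\mathcal M}(\Omega)$ onto $\Delta^J T_{\mathcal M}(\Omega)$.
   Context: $H_g=\{Z\in\mathbb C^{(g,g)}: Z={}^tZ,\ \operatorname{Im}Z>0\}$; ${}^tM$ is transpose, $\sigma$ is trace. $\mathbb M(h)$ is the set of positive definite symmetric even integral $h\times h$ matrices $\mathcal M=(\mathcal M_{kl})$ with all $\mathcal M_{kl}\ne0$. $\mathbb Z^{(h,g)}_{\ge0}$ is the set of $h\times g$ integer matrices $J=(J_{ka})$ with all $J_{ka}\ge0$. $T_{\mathcal M}(\Omega)$ is the space of entire functions $f$ on $\mathbb C^{(h,g)}$ with $f(W+\xi\Omega+\eta)=\exp\{-\pi i\sigma(\mathcal M(\xi\Omega{}^t\xi+2W{}^t\xi))\}f(W)$ for all $W$ and all $\xi,\eta\in\mathbb Z^{(h,g)}$; $T(\Omega)=\sum_{\mathcal M\in\mathbb M(h)}T_{\mathcal M}(\Omega)$. $A_{\mathcal M}(\Omega)$ is the space of functions $\varphi(Z,W)$ on $\mathbb C^{(h,g)}\times\mathbb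 C^{(h,g)}$ which are polynomials in the entries $Z_{ka}$ of $Z$ with coefficients entire in $W$, and satisfy $\varphi(Z+\xi,W+\xi\Omega+\eta)=\exp\{-\pi i\sigma(\mathcal M(\xi\Omega{}^t\xi+2W{}^t\xi))\}\varphi(Z,W)$ for all $(Z,W)$ and $\xi,\eta\in\mathbb Z^{(h,g)}$. $A(\Omega)=\sum_{\mathcal M\in\mathbb M(h)}A_{\mathcal M}(\Omega)$, graded by $\mathcal M$, containing $T(\Omega)$ as the $Z$-independent elements. For $\mathcal M\in\mathbb M(h)$, put $\partial(\mathcal M,Z,W)_{ka}=2\pi i\sum_{l=1}^h\mathcal M_{kl}Z_{la}+\frac{\partial}{\partial W_{ka}}$ ($1\le k\le h$, $1\le a\le g$). The operator $\Delta_{ka}$ on $A(\Omega)$ acts on the component in $A_{\mathcal M}(\Omega)$ as $\partial(\mathcal M,Z,W)_{ka}$, and $\Delta^J=\prod_{k,a}\Delta_{ka}^{J_{ka}}$. *)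

(* Defs.v *)
From HB Require Import structures.
From mathcomp Require Import all_boot all_order all_algebra complex.
From mathcomp Require Import all_classical all_reals all_analysis.

Set Implicit Arguments.
Unset Strict Implicit.
Unset Printing Implicit Defensive.

Import Order.TTheory GRing.Theory Num.Theory.
Import numFieldNormedType.Exports.
Local Open Scope classical_set_scope.
Local Open Scope ring_scope.

(* The topology and the normed module structure of numeric fields are found by
   inference on [Cplx R], but not on the bare [R[i]]. *)
Definition Cplx (R : realType) : numClosedFieldType := R[i]%C.

Definition cexp (R : realType) (z : Cplx R) : Cplx R :=
  ((expR (complex.Re z) * cos (complex.Im z)) +i*
   (expR (complex.Re z) * sin (complex.Im z)))%C.

Definition pi_i (R : realType) : Cplx R := (0 +i* pi)%C.

Section Subspaces.
Context {K : nzRingType}.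

Definition subspace (E : lmodType K) (V : set E) : Prop :=
  V 0 /\ forall (c : K) x y, V x -> V y -> V (c *: x + y).

Definition decomposes (I : choiceType) (E : lmodType K)
    (P : set I) (V : I -> set E) (x : E) (u : I -> E) : Prop :=
  [/\ forall i, P i -> V i (u i),
      forall i, ~ P i -> u i = 0,
      finite_set [set i | u i != 0] &
      x = \sum_(i \in P) u i].

Definition sum_space (I : choiceType) (E : lmodType K)
    (P : set I) (V : I -> set E) : set E :=
  [set x | exists u, decomposes P V x u].

(* [X] is the internal direct sum of the subspaces [V i], for [i] in [P]. *)
Definition direct_sum (I : choiceType) (E : lmodType K)
    (P : set I) (V : I -> set E) (X : set E) : Prop :=
  [/\ forall i, P i -> subspace (V i),
      X = sum_space P V &
      forall x u v, decomposes P V x u -> decomposes P V x v -> u = v].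

Definition linear_isomorphism (E F : lmodType K)
    (V : set E) (W : set F) (f : E -> F) : Prop :=
  [/\ subspace V, subspace W,
      forall (c : K) x y, V x -> V y -> f (c *: x + y) = c *: f x + f y &
      set_bij V W f].

End Subspaces.

Definition posdef (R : realType) (n : nat) (S : 'M[R]_n) : Prop :=
  forall x : 'cV[R]_n, x != 0 -> 0 < (x^T *m S *m x) 0 0.

Definition siegel (R : realType) (g : nat) : set 'M[Cplx R]_g :=
  [set Om | Om^T = Om /\ posdef (map_mx (@complex.Im R) Om)].

(* The real field [R] only serves to express positive definiteness. An integral
   symmetric matrix is even when its diagonal entries are even. *)
Definition even_posdef (R : realType) (h : nat) : set 'M[int]_h :=
  [set M | [/\ M^T = M, posdef (map_mx intr M : 'M[R]_h),
               forall k, (2 %| M k k)%Z & forall k l, M k l != 0]].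

Section ThetaFunctions.
Context {R : realType} {h g : nat}.
Local Notation C := (Cplx R).
Local Notation MC := 'M[C]_(h, g).
Local Notation MZ := 'M[int]_(h, g).
Local Notation MN := 'M[nat]_(h, g).

Definition entire (f : MC -> C) : Prop := forall W, differentiable f W.

Definition mulZ (xi : MZ) (Om : 'M[C]_g) : MC := map_mx intr xi *m Om.

Definition theta_factor (M : 'M[int]_h) (Om : 'M[C]_g) (xi : MZ) (W : MC) : C :=
  let X : MC := map_mx intr xi in
  cexp (- pi_i R * \tr (map_mx intr M *m (X *m Om *m X^T + 2 *: (W *m X^T)))).

Definition theta_space (Om : 'M[C]_g) (M : 'M[int]_h) : set (MC -> C) :=
  [set f | entire f /\
    forall (W : MC) (xi eta : MZ),
      f (W + mulZ xi Om + map_mx intr eta) = theta_factor M Om xi W * f W].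

Definition theta_total (Om : 'M[C]_g) : set (MC -> C) :=
  sum_space (even_posdef R (h := h)) (theta_space Om).

Definition monomial (J : MN) (Z : MC) : C := \prod_k \prod_a Z k a ^+ J k a.

Definition polynomial_entire (phi : MC -> MC -> C) : Prop :=
  exists (s : seq MN) (c : MN -> MC -> C),
    (forall J, entire (c J)) /\
    forall Z W, phi Z W = \sum_(J <- s) c J W * monomial J Z.

Definition aux_space (Om : 'M[C]_g) (M : 'M[int]_h) : set (MC -> MC -> C) :=
  [set phi | polynomial_entire phi /\
    forall (Z W : MC) (xi eta : MZ),
      phi (Z + map_mx intr xi) (W + mulZ xi Om + map_mx intr eta) =
      theta_factor M Om xi W * phi Z W].

Definition aux_total (Om : 'M[C]_g) : set (MC -> MC -> C) :=
  sum_space (even_posdef R (h := h)) (aux_space Om).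

Definition Zfree (f : MC -> C) : MC -> MC -> C := fun _ W => f W.

Definition partial_op (M : 'M[int]_h) (k : 'I_h) (a : 'I_g)
    (phi : MC -> MC -> C) : MC -> MC -> C :=
  fun Z W => 2 * pi_i R * (\sum_l (M k l)%:~R * Z l a) * phi Z W
             + 'D_(delta_mx k a) (phi Z) W.

(* The homogeneous components of [phi] for the grading of [aux_total Om] by the
   matrices [M]. The sum of the spaces [aux_space Om M] is direct, so that there
   is nothing to choose when [phi] is in [aux_total Om]; the value is [0] for
   other functions. *)
Definition component (Om : 'M[C]_g) (phi : MC -> MC -> C) :
    'M[int]_h -> MC -> MC -> C :=
  xget (fun=> 0) [set u | decomposes (even_posdef R (h := h)) (aux_space Om) phi u].

Definition Delta (Om : 'M[C]_g) (k : 'I_h) (a : 'I_g)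
    (phi : MC -> MC -> C) : MC -> MC -> C :=
  \sum_(M \in even_posdef R (h := h)) partial_op M k a (component Om phi M).

(* The factors commute on [aux_total Om]; they are composed in the order of the
   enumeration of ['I_h * 'I_g]. *)
Definition DeltaJ (Om : 'M[C]_g) (J : MN) : (MC -> MC -> C) -> (MC -> MC -> C) :=
  \big[(fun F G => F \o G)/idfun]_(p : 'I_h * 'I_g)
     iter (J p.1 p.2) (Delta Om p.1 p.2).

End ThetaFunctions.

(* Main.v *)
Require Import Defs.
From HB Require Import structures.
From mathcomp Require Import all_boot all_order all_algebra complex.
From mathcomp Require Import all_classical all_reals all_analysis.
From mathcomp Require Import ring lra.
Import Order.TTheory GRing.Theory Num.Theory.
Import numFieldNormedType.Exports.
Set Implicit Arguments.
Unset Strict Implicit.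
Unset Printing Implicit Defensive.
Local Open Scope classical_set_scope.
Local Open Scope ring_scope.
Local Notation subspace := Defs.subspace.

(* Write [Y = 2 pi i M Z].  On [aux_space Om M] the operator [Delta k a] is
   [Y k a + d / d W k a], so that [Delta^J f = Y^J f + terms of lower degree in Z]
   for [f] in [theta_space Om M].  Conversely the quasi-periodicity of an element
   of [aux_space Om M], read in top degree, says that its top coefficients with
   respect to the monomials [Y^J] are theta functions; subtracting the
   corresponding [Delta^J f] lowers the degree.  This gives existence, and
   comparing top degrees gives uniqueness and injectivity.

   The spaces [aux_space Om M] are independent for different [M]: translating by
   [n xi] turns a linear relation between them into
   [sum_M a_M u_M^(n^2) v_M^n = 0], where the [|u_M|] are different for a
   suitable [xi] of rank one, and the largest [|u_M|] dominates.

   The derivative of an entire function is entire, although differentiability is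
   only assumed pointwise: Goursat's bisection, run on trapezoid sums instead of
   integrals, gives Cauchy's estimate for the first derivative; this estimate,
   applied to increments of the function, shows that the derivative is Lipschitz,
   and then that it is differentiable. *)

(** * The real-valued norm and differentiability *)

(** Complex analysis enters because [partial_op] differentiates the coefficients in [W], and the
    results must again be entire. Trapezoid sums suffice for this: at every finite level they are
    additive under bisection, exact on affine functions and bounded by length times supremum, so
    that limits of integrals become statements about all sufficiently large levels. The independence
    of the spaces [aux_space Om M] has to precede any computation with [Delta], since [component]
    picks a decomposition and is under control only once this decomposition is unique. The rank one
    choice of [xi] reduces [|u_M|] to the value of the quadratic form of [M] at one integral vector,
    so that separating finitely many [M] becomes a question about integer polynomials. The passage
    from [Z] to [Y] requires [M] to be invertible, which positive definiteness provides. Top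
    coefficients behave well because a translation of [Z] changes a polynomial only in lower degree,
    and a derivative in [W] does not raise the degree in [Z]. *)

Section ModulusAndDerivative.
Context {R : realType}.
Local Notation C := (Cplx R).

(** The norm of a normed module over [C] has its values in [C]. Its real part carries the same
    information and lives in the ordered field [R], where suprema, [lra] and [nra] are available. *)
Definition nrm (V : normedModType C) (x : V) : R := complex.Re `|x|.

Section NormedModule.
Context {V : normedModType C}.
Implicit Types x y : V.

Lemma nrmE x : `|x| = (nrm x)%:C%C.
Proof. by rewrite RRe_real // normr_real. Qed.

Lemma nrm_ge0 x : 0 <= nrm x.
Proof. by rewrite -ler0c -nrmE normr_ge0. Qed.

Lemma nrm0 : nrm (0 : V) = 0.
Proof. by apply: (@complexI R); rewrite -nrmE normr0. Qed.

Lemma nrm0_eq0 x : nrm x = 0 -> x = 0.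
Proof. by move=> x0; apply/eqP; rewrite -normr_eq0 nrmE x0. Qed.

Lemma nrmN x : nrm (- x) = nrm x.
Proof. by rewrite /nrm normrN. Qed.

Lemma nrmD x y : nrm (x + y) <= nrm x + nrm y.
Proof. by rewrite -lecR rmorphD /= -!nrmE ler_normD. Qed.

Lemma nrmB x y : nrm (x - y) <= nrm x + nrm y.
Proof. by rewrite (le_trans (nrmD _ _)) // nrmN. Qed.

Lemma nrmZ (c : C) x : nrm (c *: x) = nrm c * nrm x.
Proof. by apply: (@complexI R); rewrite rmorphM /= -!nrmE normrZ. Qed.

End NormedModule.

Lemma nrmM (x y : C) : nrm (x * y) = nrm x * nrm y.
Proof. by apply: (@complexI R); rewrite rmorphM /= -!nrmE normrM. Qed.

Lemma nrm1 : nrm (1 : C) = 1.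
Proof. by apply: (@complexI R); rewrite -nrmE normr1. Qed.

Lemma nrmV (x : C) : nrm x^-1 = (nrm x)^-1.
Proof. by apply: (@complexI R); rewrite -nrmE fmorphV /= -nrmE normfV. Qed.

Lemma nrmX (x : C) n : nrm (x ^+ n) = nrm x ^+ n.
Proof. by elim: n => [|n IH]; rewrite ?expr0 ?nrm1 // !exprS nrmM IH. Qed.

Lemma nrm_Re (x : C) : `|complex.Re x| <= nrm x.
Proof. by rewrite -lecR -nrmE; exact: normc_ge_Re. Qed.

Lemma nrm_real (x : R) : nrm (x%:C%C : C) = `|x|.
Proof. by rewrite /nrm normc_def /= expr0n /= addr0 sqrtr_sqr. Qed.

Lemma nrm_nat n : nrm (n%:R : C) = n%:R.
Proof. by rewrite -(rmorph_nat (real_complex R)) nrm_real ger0_norm. Qed.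

Lemma nrm_i : nrm ('i%C : C) = 1.
Proof. by rewrite /nrm normc_def /= expr0n /= add0r expr1n sqrtr1. Qed.

Lemma nrm_Im (x : C) : `|complex.Im x| <= nrm x.
Proof.
rewrite -[nrm x]mul1r -nrm_i -nrmM mulrC.
rewrite -[X in `|X|]opprK normrN -ReiNIm; exact: nrm_Re.
Qed.

Lemma nrm_ReIm (x : C) : nrm x <= `|complex.Re x| + `|complex.Im x|.
Proof.
rewrite [x in nrm x]complexE (le_trans (nrmD _ _)) // nrmM nrm_i mul1r.
by rewrite !nrm_real.
Qed.

Lemma nbhs_nrmP (V : normedModType C) (x : V) (P : set V) :
  nbhs x P <-> exists2 d : R, 0 < d & forall y, nrm (y - x) < d -> P y.
Proof.
split=> [/nbhs_ballP [e /= e0 eP]|[d d0 dP]].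
  have er : e \is Num.real by rewrite gtr0_real.
  exists (complex.Re e); first by rewrite -ltcR RRe_real.
  move=> y yx; apply: eP; rewrite -ball_normE /= distrC nrmE -(RRe_real er).
  by rewrite ltcR.
apply/nbhs_ballP; exists d%:C%C => /=; first by rewrite ltcR.
by move=> y; rewrite -ball_normE /= distrC nrmE ltcR; exact: dP.
Qed.

(** [L] is a bare function, so that estimates can be stated before its linearity is known;
    [has_diffP] makes the link with the library once [L] is linear and continuous. *)
Definition has_diff (V : normedModType C) (f : V -> C) (W : V) (L : V -> C) :=
  forall e : R, 0 < e -> exists2 d : R, 0 < d &
    forall H, nrm H < d -> nrm (f (W + H) - f W - L H) <= e * nrm H.

Lemma has_diffP (V : normedModType C) (f : V -> C) (W : V) (L : {linear V -> C}) :
  continuous L ->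
  (f \o shift W = cst (f W) + L +o_ 0 id <-> has_diff f W L).
Proof.
move=> Lc; split.
  move=> /eqaddoP fo e e0.
  have e0' : (0 : C) < e%:C%C by rewrite ltcR.
  move: (fo _ e0') => /nbhs_nrmP [d d0 dP]; exists d => // H Hd.
  have := dP H; rewrite subr0 => /(_ Hd) /=.
  by rewrite !fctE /= !nrmE -rmorphM /= lecR opprD addrA [W + H]addrC.
move=> fL; apply/eqaddoP => e e0.
have er : e \is Num.real by rewrite gtr0_real.
have [|d d0 dP] := fL (complex.Re e); first by rewrite -ltcR RRe_real.
apply/nbhs_nrmP; exists d => // H; rewrite subr0 => /dP.
by rewrite !fctE /= !nrmE -(RRe_real er) -rmorphM /= lecR opprD addrA [W + H]addrC.
Qed.

Lemma differentiable_has_diff (V : normedModType C) (f : V -> C) (W : V) :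
  differentiable f W -> has_diff f W (fun v => 'D_v f W).
Proof.
move=> df; have dfc := diff_continuous df.
have /has_diffP -/(_ dfc) fL := diff_locally df.
move=> e /fL [d d0 dP]; exists d => // H /dP; rewrite -deriveE //.
Qed.

Lemma has_diff_differentiable (V : normedModType C) (f : V -> C) (W : V)
    (L : {linear V -> C}) :
  continuous L -> has_diff f W L ->
  differentiable f W /\ forall v, 'D_v f W = L v.
Proof.
move=> Lc /has_diffP -/(_ Lc) fL.
have dE := diff_unique Lc fL.
have df : differentiable f W.
  by apply/diff_locallyP; split; [move=> x; rewrite dE; exact: Lc|rewrite dE].
by split=> // v; rewrite deriveE // dE.
Qed.

End ModulusAndDerivative.

(** * The complex exponential *)

Section ComplexExponential.
Context {R : realType}.
Local Notation C := (Cplx R).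
Implicit Types z w : C.

Lemma real_has_diff (f : R -> R) (x d : R) : is_derive x 1 f d ->
  forall e : R, 0 < e -> exists2 r : R, 0 < r &
    forall t, `|t| < r -> `|f (x + t) - f x - d * t| <= e * `|t|.
Proof.
move=> fd e e0; have df : differentiable f x by apply/derivable1_diffP; exact: ex_derive.
have /eqaddoP /(_ _ e0) /nbhs_ballP [r /= r0 rP] := diff_locally df.
exists r => // t tr; have /= := rP t.
rewrite -ball_normE /= sub0r normrN => /(_ tr).
have dfd : derivable f x 1 by exact: ex_derive.
have := congr1 (fun h : R -> R => h t) (deriv1E dfd).
rewrite derive1E derive_val => dE.
have -> : d * t = 'd f x t by rewrite dE [LHS]mulrC.
by rewrite !fctE /= opprD addrA [x + t]addrC.
Qed.

Lemma cexpD z w : cexp (z + w) = cexp z * cexp w.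
Proof.
case: z => a b; case: w => c d; rewrite /cexp /= expRD cosD sinD.
by apply/eqP; rewrite eq_complex /=; apply/andP; split; apply/eqP; ring.
Qed.

Lemma cexp0 : cexp (0 : C) = 1.
Proof. by rewrite /cexp /= expR0 cos0 sin0 mulr1 mulr0. Qed.

Lemma nrm_cexp z : nrm (cexp z) = expR (complex.Re z).
Proof.
rewrite /nrm normc_def /= !exprMn -mulrDr cos2Dsin2 mulr1 sqrtr_sqr.
by rewrite ger0_norm // expR_ge0.
Qed.

Lemma cexp_neq0 z : cexp z != 0.
Proof.
apply/eqP => z0; have := nrm_cexp z; rewrite z0 nrm0 => /esym/eqP.
by rewrite gt_eqF ?expR_gt0.
Qed.

Lemma cexpN z : cexp (- z) = (cexp z)^-1.
Proof.
apply: (mulfI (cexp_neq0 z)); rewrite -cexpD subrr cexp0 mulfV //.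
exact: cexp_neq0.
Qed.

Lemma cexp_pi_i : cexp (pi_i R) = -1.
Proof.
rewrite /cexp /= expR0 cospi sinpi !mul1r.
by apply/eqP; rewrite eq_complex /= oppr0 !eqxx.
Qed.

Lemma cexp_has_diff0 e : 0 < e -> exists2 d : R, 0 < d &
  forall z, nrm z < d -> nrm (cexp z - 1 - z) <= e * nrm z.
Proof.
(* The errors of the real and imaginary parts add up to 3 and 4 times [e / 9 * n], within the 9
   available. The minimum with 1 serves to bound [sin b] by twice [n]. *)
move=> e0; have e9 : 0 < Num.min (e / 9) 1 by rewrite lt_min ltr01 divr_gt0.
have [r1 r10 r1P] := real_has_diff (is_derive_expR 0) e9.
have [r2 r20 r2P] := real_has_diff (is_derive_cos 0) e9.
have [r3 r30 r3P] := real_has_diff (is_derive_sin 0) e9.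
exists (Num.min (Num.min r1 r2) (Num.min r3 (Num.min 1 (e / 9)))).
  by rewrite !lt_min r10 r20 r30 ltr01 divr_gt0.
case=> a b; rewrite !lt_min => /andP[/andP[z1 z2] /andP[z3 /andP[z4 z5]]].
have /= an := nrm_Re (a +i* b)%C; have /= bn := nrm_Im (a +i* b)%C.
move: (nrm _) an bn z1 z2 z3 z4 z5 => n an bn z1 z2 z3 z4 z5.
have := r1P a (le_lt_trans an z1); have := r2P b (le_lt_trans bn z2).
have := r3P b (le_lt_trans bn z3).
rewrite !(add0r, expR0, sin0, cos0, oppr0, mul0r, addr0, mul1r).
set s := sin b; set c := cos b; set x := expR a => hs hc hx.
have n0 : 0 <= n by exact: le_trans an.
have m9 : Num.min (e / 9) 1 <= e / 9 by rewrite ge_min lexx.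
have m1 : Num.min (e / 9) 1 <= 1 by rewrite ge_min lexx orbT.
have M (t : R) : `|t| <= n -> Num.min (e / 9) 1 * `|t| <= e / 9 * n.
  by move=> tn; rewrite ler_pM // ltW.
have M1 (t : R) : `|t| <= n -> Num.min (e / 9) 1 * `|t| <= n.
  by move=> tn; rewrite -[leRHS]mul1r ler_pM // ltW.
have xb : `|x - 1 - a| <= e / 9 * n by exact: le_trans hx (M _ an).
have cb : `|c - 1| <= e / 9 * n by exact: le_trans hc (M _ bn).
have sb : `|s - b| <= e / 9 * n by exact: le_trans hs (M _ bn).
have c1 : `|c| <= 1 by rewrite ler_norml cos_geN1 cos_le1.
have s1 : `|s| <= 1 by rewrite ler_norml sin_geN1 sin_le1.
have a1 : `|a| <= 1 by rewrite ltW // (le_lt_trans an).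
have a9 : `|a| <= e / 9 by rewrite ltW // (le_lt_trans an).
apply: le_trans (nrm_ReIm _) _ => /=.
have -> : x * c - 1 - a = (x - 1 - a) * c + (c - 1) + a * (c - 1) by ring.
have -> : x * s + - 0 - b = (x - 1 - a) * s + (s - b) + a * s by rewrite oppr0; ring.
have h1 : `|(x - 1 - a) * c + (c - 1) + a * (c - 1)| <= e / 9 * n *+ 3.
  rewrite (le_trans (ler_normD _ _)) // mulrS [leRHS]addrC mulr2n lerD //.
    rewrite (le_trans (ler_normD _ _)) // lerD // normrM.
    by rewrite -[leRHS]mulr1 ler_pM.
  by rewrite normrM -[leRHS]mul1r ler_pM.
have h2 : `|(x - 1 - a) * s + (s - b) + a * s| <= e / 9 * n *+ 4.
  have sn : `|s| <= n *+ 2.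
    have -> : s = (s - b) + b by ring.
    rewrite (le_trans (ler_normD _ _)) // mulr2n lerD //.
    exact: le_trans hs (M1 _ bn).
  rewrite (le_trans (ler_normD _ _)) //.
  have -> : e / 9 * n *+ 4 = e / 9 * n *+ 2 + e / 9 * (n *+ 2).
    by rewrite mulrnAr -mulrnDr.
  rewrite lerD //; last by rewrite normrM ler_pM.
  rewrite (le_trans (ler_normD _ _)) // mulr2n lerD // normrM.
  by rewrite -[leRHS]mulr1 ler_pM.
apply: le_trans (lerD h1 h2) _; 
have -> : e * n = e / 9 * n *+ 9 by rewrite -mulr_natr; field.
by rewrite -mulrnDr ler_wpMn2l // mulr_ge0 // divr_ge0 // ltW.
Qed.

Lemma cexp_has_diff z : has_diff (@cexp R : C -> C) z (fun w => cexp z * w).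
Proof.
move=> e e0; have c0 : 0 < nrm (cexp z) by rewrite nrm_cexp expR_gt0.
have [d d0 dP] := cexp_has_diff0 (divr_gt0 e0 c0).
exists d => // w /dP wd; rewrite cexpD.
have -> : cexp z * cexp w - cexp z - cexp z * w = cexp z * (cexp w - 1 - w).
  by ring.
rewrite nrmM; apply: le_trans (ler_wpM2l (nrm_ge0 _) wd) _.
by rewrite mulrA mulrCA mulfV ?mulr1 // gt_eqF.
Qed.

Lemma is_diff_cexp z : is_diff z (@cexp R : C -> C) ( *%R (cexp z)).
Proof.
have lc : linear ( *%R (cexp z) : C -> C).
  by move=> a x y; rewrite mulrDr -[a *: x]/(a * x) mulrCA.
pose L : {linear C -> C} := HB.pack ( *%R (cexp z)) (GRing.isLinear.Build _ _ _ _ _ lc).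
have Lc : continuous L by exact: mulrl_continuous.
have [df dE] := @has_diff_differentiable R C (@cexp R) z L Lc (cexp_has_diff z).
apply: DiffDef => //; apply/funext => v.
by rewrite -deriveE // dE.
Qed.

End ComplexExponential.

(** * Goursat's theorem and Cauchy's estimate *)

Section Goursat.
Context {R : realType}.
Local Notation C := (Cplx R).

(** The intervals of centre [x n] and radius [2 * K / 2 ^+ n] are nested, so the supremum of their
    left ends lies in all of them. The limit comes with its rate. *)
Lemma geometric_cvg (x : nat -> R) K :
  (forall n, `|x n.+1 - x n| <= K / 2 ^+ n) ->
  exists l, forall n, `|x n - l| <= 2 * K / 2 ^+ n.
Proof.
move=> xK; pose r n : R := 2 * K / 2 ^+ n.
have rS n : r n = r n.+1 + K / 2 ^+ n.
  rewrite /r exprS; field; by rewrite expf_neq0.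
have K0 : 0 <= K.
  by have := le_trans (normr_ge0 _) (xK 0%N); rewrite expr0 divr1.
have r0 n : 0 <= r n by rewrite /r divr_ge0 ?mulr_ge0 // exprn_ge0.
have lo n k : x n - r n <= x (n + k)%N - r (n + k)%N.
  elim: k => [|k IH]; first by rewrite addn0.
  apply: le_trans IH _; rewrite addnS.
  have := xK (n + k)%N; rewrite ler_norml => /andP[h _].
  have := rS (n + k)%N; lra.
have hi n k : x (n + k)%N + r (n + k)%N <= x n + r n.
  elim: k => [|k IH]; first by rewrite addn0.
  apply: le_trans _ IH; rewrite addnS.
  have := xK (n + k)%N; rewrite ler_norml => /andP[_ h].
  have := rS (n + k)%N; lra.
have lohi n m : x n - r n <= x m + r m.
  have h1 := lo n m; have h2 := hi m n; rewrite addnC in h2.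
  have := r0 (n + m)%N; lra.
pose A := [set x n - r n | n in [set: nat]].
have Aub n : ubound A (x n + r n) by move=> _ [m _ <-].
have A0 : A !=set0 by exists (x 0%N - r 0%N), 0%N.
exists (sup A) => n; rewrite ler_distl; apply/andP; split.
  have : sup A <= x n + r n by exact: ge_sup.
  by rewrite /r; lra.
have : x n - r n <= sup A by apply: sup_upper_bound; [split=> //; exists (x n + r n)|exists n].
by rewrite /r; lra.
Qed.

Lemma geometric_cvgC (z : nat -> C) K :
  (forall n, nrm (z n.+1 - z n) <= K / 2 ^+ n) ->
  exists l, forall n, nrm (z n - l) <= 4 * K / 2 ^+ n.
Proof.
move=> zK.
have [n|a aP] := @geometric_cvg (fun n => complex.Re (z n)) K.
  by apply: le_trans (zK n); apply: le_trans _ (nrm_Re _); case: (z _) (z _) => ? ? [].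
have [n|b bP] := @geometric_cvg (fun n => complex.Im (z n)) K.
  by apply: le_trans (zK n); apply: le_trans _ (nrm_Im _); case: (z _) (z _) => ? ? [].
exists (a +i* b)%C => n; have := aP n; have := bP n.
case: (z n) => x y /= yb xa; apply: le_trans (nrm_ReIm _) _ => /=.
have -> : 4 * K / 2 ^+ n = 2 * K / 2 ^+ n + 2 * K / 2 ^+ n.
  by field; rewrite expf_neq0.
exact: lerD.
Qed.

(* Trapezoid sum for the integral of [u] over the segment from [p] to [p + d],
   cut into [2 ^ m] pieces. *)
Fixpoint trapezoid (u : C -> C) m (p d : C) : C :=
  if m is m'.+1 then trapezoid u m' p (d / 2) + trapezoid u m' (p + d / 2) (d / 2)
  else (u p + u (p + d)) / 2 * d.

Implicit Types (u v : C -> C) (p c d L : C).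

Lemma trapezoidB u v m p d :
  trapezoid (fun w => u w - v w) m p d = trapezoid u m p d - trapezoid v m p d.
Proof. by elim: m p d => [|m IH] p d /=; rewrite ?IH; field. Qed.

(** The trapezoid rule is exact on affine functions: the right-hand side is the integral, whatever
    the level [m]. *)
Lemma trapezoid_affine (a b : C) m p d :
  trapezoid (fun w => a + b * w) m p d = a * d + b * (d * (p + d / 2)).
Proof. by elim: m p d => [|m IH] p d /=; rewrite ?IH; field. Qed.

Lemma trapezoid_bound u m p d B :
  (forall t : R, 0 <= t <= 1 -> nrm (u (p + (t%:C%C : C) * d)) <= B) ->
  nrm (trapezoid u m p d) <= B * nrm d.
Proof.
have n2 : nrm (2^-1 : C) = 2^-1 by rewrite nrmV nrm_nat.
elim: m p d => [|m IH] p d uB /=.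
  rewrite !nrmM n2 ler_wpM2r ?nrm_ge0 //.
  have h0 := uB 0; have h1 := uB 1.
  rewrite mul0r addr0 lexx ler01 in h0; rewrite mul1r lexx ler01 in h1.
  have := nrmD (u p) (u (p + d)); have := h0 isT; have := h1 isT; lra.
have half x : nrm (d / 2) * x = x * nrm d / 2 by rewrite nrmM n2; ring.
have -> : B * nrm d = B * nrm (d / 2) + B * nrm (d / 2).
  by rewrite nrmM n2; field.
rewrite (le_trans (nrmD _ _)) // lerD // IH // => t /andP[t0 t1].
  have -> : (t%:C%C : C) * (d / 2) = (t / 2)%:C%C * d.
    by rewrite rmorphM fmorphV rmorph_nat /=; field.
  by apply: uB; apply/andP; split; lra.
have -> : p + d / 2 + (t%:C%C : C) * (d / 2) = p + ((1 + t) / 2)%:C%C * d.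
  by rewrite rmorphM fmorphV rmorphD rmorph1 rmorph_nat /=; field.
by apply: uB; apply/andP; split; lra.
Qed.

Lemma trapezoid_periodic u m p d T : (forall w, u (w + T) = u w) ->
  trapezoid u m (p + T) d = trapezoid u m p d.
Proof.
move=> uT; elim: m p d => [|m IH] p d /=; first by rewrite addrAC !uT.
by rewrite addrAC !IH.
Qed.

(** Discrete contour integral, counterclockwise, around the square with corner [c] and side [a]; the
    top and left sides are run backwards, hence the minus signs. *)
Definition square_sum u m (c a : C) : C :=
  trapezoid u m c a + trapezoid u m (c + a) (('i%C : C) * a)
  - trapezoid u m (c + ('i%C : C) * a) a - trapezoid u m c (('i%C : C) * a).

(** The recursion of [trapezoid] halves a segment, so level [m.+1] on the square matches level [m]
    on its quarters exactly. Each inner segment occurs twice with opposite signs. *)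
Lemma square_sum_split u m c (a : C) :
  square_sum u m.+1 c a =
  square_sum u m c (a / 2) + square_sum u m (c + a / 2) (a / 2)
  + square_sum u m (c + ('i%C : C) * (a / 2)) (a / 2)
  + square_sum u m (c + a / 2 + ('i%C : C) * (a / 2)) (a / 2).
Proof.
rewrite /square_sum /= -!mulrA.
set b := a / 2; set j := ('i%C : C) * b.
have -> : a = b + b by rewrite /b; field.
have -> : ('i%C : C) * (b + b) = j + j by rewrite /j; ring.
rewrite !addrA.
have -> : c + j + j + b = c + b + j + j by ring.
have -> : c + j + b = c + b + j by ring.
have -> : c + b + j + b = c + b + b + j by ring.
ring.
Qed.

Lemma square_sum_affine (a b : C) m c d : square_sum (fun w => a + b * w) m c d = 0.
Proof.
rewrite /square_sum !trapezoid_affine.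
move: ('i%C : C) => j; by field.
Qed.

(** Subtracting the affine approximation at [p] leaves the sum unchanged. Points of the square are
    within [4 + 2 = 6] times [nrm a] of [p], and the four sides contribute [6 * e * nrm a ^+ 2]
    each, whence 24. *)
Lemma square_sum_local u p L e (d : R) m c (a : C) :
  (forall H, nrm H < d -> nrm (u (p + H) - u p - L * H) <= e * nrm H) ->
  0 <= e -> nrm (c - p) <= 4 * nrm a -> 6 * nrm a < d ->
  nrm (square_sum u m c a) <= 24 * e * nrm a ^+ 2.
Proof.
move=> uL e0 cp ad.
pose v w := u w - (u p - L * p + L * w).
have -> : square_sum u m c a = square_sum v m c a.
  have := square_sum_affine (u p - L * p) L m c a.
  rewrite /v /square_sum !trapezoidB => h.
  by rewrite -[LHS]subr0 -h; ring.
have vB s t : 0 <= s <= 1 -> 0 <= t <= 1 ->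
    nrm (v (c + ((s%:C%C : C) * a + (t%:C%C : C) * (('i%C : C) * a)))) <= 6 * e * nrm a.
  move=> /andP[s0 s1] /andP[t0 t1].
  set w := _ + _; have wp : nrm (w - p) <= 6 * nrm a.
    have -> : w - p = (c - p) + ((s%:C%C : C) * a + (t%:C%C : C) * (('i%C : C) * a)).
      by rewrite /w; ring.
    apply: le_trans (nrmD _ _) _.
    have := nrmD ((s%:C%C : C) * a) ((t%:C%C : C) * (('i%C : C) * a)).
    rewrite !nrmM nrm_i !nrm_real !ger0_norm // mul1r.
    have := nrm_ge0 a; nra.
  have := uL (w - p) (le_lt_trans wp ad).
  have -> : u (p + (w - p)) - u p - L * (w - p) = v w.
    by rewrite /v [p + _]addrC subrK; ring.
  move=> /le_trans; apply.
  by rewrite [6 * e]mulrC -mulrA ler_wpM2l.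
have i1 : nrm (('i%C : C) * a) = nrm a by rewrite nrmM nrm_i mul1r.
have h00 : 0 <= (0 : R) <= 1 by apply/andP; split; lra.
have h11 : 0 <= (1 : R) <= 1 by apply/andP; split; lra.
have e1 : nrm (trapezoid v m c a) <= 6 * e * nrm a * nrm a.
  apply: trapezoid_bound => t t01.
  by have := vB t 0 t01 h00; rewrite mul0r addr0.
have e2 : nrm (trapezoid v m (c + a) (('i%C : C) * a)) <= 6 * e * nrm a * nrm a.
  rewrite -{2}i1; apply: trapezoid_bound => t t01.
  by have := vB 1 t h11 t01; rewrite mul1r addrA.
have e3 : nrm (trapezoid v m (c + ('i%C : C) * a) a) <= 6 * e * nrm a * nrm a.
  apply: trapezoid_bound => t t01.
  by have := vB t 1 t01 h11; rewrite mul1r [(t%:C%C : C) * a + _]addrC addrA.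
have e4 : nrm (trapezoid v m c (('i%C : C) * a)) <= 6 * e * nrm a * nrm a.
  rewrite -{2}i1; apply: trapezoid_bound => t t01.
  by have := vB 0 t h00 t01; rewrite mul0r add0r.
have -> : 24 * e * nrm a ^+ 2 = 6 * e * nrm a * nrm a + 6 * e * nrm a * nrm a
   + 6 * e * nrm a * nrm a + 6 * e * nrm a * nrm a by ring.
rewrite /square_sum (le_trans (nrmB _ _)) // lerD //.
rewrite (le_trans (nrmB _ _)) // lerD //.
by rewrite (le_trans (nrmD _ _)) // lerD.
Qed.

Lemma goursat (u : C -> C) (c a : C) e :
  (forall p, exists L, has_diff u p ( *%R L)) -> 0 < e ->
  exists m0, forall m, (m0 <= m)%N ->
    nrm (square_sum u m c a) <= e * nrm a ^+ 2.
Proof.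
move=> ud e0.
(* The bound for a square is the sum of the bounds for its quarters, so [P] passes from the quarters
   to the square and its failure passes to some quarter. *)
pose P c a := exists m0, forall m, (m0 <= m)%N ->
    nrm (square_sum u m c a) <= e * nrm a ^+ 2.
have n2 x : nrm (x / 2 : C) = nrm x / 2 by rewrite nrmM nrmV nrm_nat.
have split_P x y : P x (y / 2) -> P (x + y / 2) (y / 2) ->
    P (x + ('i%C : C) * (y / 2)) (y / 2) -> P (x + y / 2 + ('i%C : C) * (y / 2)) (y / 2) ->
    P x y.
  move=> [m1 h1] [m2 h2] [m3 h3] [m4 h4].
  exists (m1 + m2 + m3 + m4).+1 => -[//|m] mm; rewrite square_sum_split.
  have -> : e * nrm y ^+ 2 = e * nrm (y / 2) ^+ 2 + e * nrm (y / 2) ^+ 2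
    + e * nrm (y / 2) ^+ 2 + e * nrm (y / 2) ^+ 2 by rewrite n2; field.
  have {}mm : (m1 + m2 + m3 + m4 <= m)%N by [].
  rewrite (le_trans (nrmD _ _)) // lerD //; last first.
    by apply: h4; rewrite (leq_trans _ mm) // leq_addl.
  rewrite (le_trans (nrmD _ _)) // lerD //; last first.
    by apply: h3; rewrite (leq_trans _ mm) // -addnA addnC -addnA leq_addr.
  rewrite (le_trans (nrmD _ _)) // lerD //.
    by apply: h1; rewrite (leq_trans _ mm) // -!addnA leq_addr.
  by apply: h2; rewrite (leq_trans _ mm) // -!addnA addnCA leq_addr.
apply: contrapT => nP.
have step (ca : C * C) : exists x, ~ P ca.1 ca.2 ->
    nrm (x - ca.1) <= nrm ca.2 /\ ~ P x (ca.2 / 2).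
  case: ca => x y /=.
  have [Pxy|nPxy] := pselect (P x y); first by exists 0.
  have y0 := nrm_ge0 y.
  have ny : nrm (y / 2) <= nrm y by rewrite n2; lra.
  have niy : nrm (('i%C : C) * (y / 2)) <= nrm y by rewrite nrmM nrm_i mul1r.
  have [P1|?] := pselect (P x (y / 2)); last first.
    by exists x; rewrite subrr nrm0.
  have [P2|?] := pselect (P (x + y / 2) (y / 2)); last first.
    by exists (x + y / 2); rewrite [_ - x]addrAC subrr add0r.
  have [P3|?] := pselect (P (x + ('i%C : C) * (y / 2)) (y / 2)); last first.
    by exists (x + ('i%C : C) * (y / 2)); rewrite [_ - x]addrAC subrr add0r.
  exists (x + y / 2 + ('i%C : C) * (y / 2)) => _; split; last first.
    by move=> P4; apply: nPxy; apply: split_P.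
  have -> : x + y / 2 + ('i%C : C) * (y / 2) - x = y / 2 + ('i%C : C) * (y / 2) by ring.
  rewrite (le_trans (nrmD _ _)) //.
  rewrite [nrm (('i%C : C) * _)]nrmM nrm_i mul1r n2.
  by lra.
have [nx nxP] := choice step.
pose F (ca : C * C) := (nx ca, ca.2 / 2).
pose s n := iter n F (c, a).
have s2 n : (s n).2 = a / 2 ^+ n.
  elim: n => [|n IH]; first by rewrite expr0 divr1.
  by rewrite /s iterS /= -/(s n) IH exprS; field; rewrite expf_neq0.
have sP n : ~ P (s n).1 (s n).2.
  by elim: n => [//|n IH]; rewrite /s iterS /= -/(s n); have [] := nxP _ IH.
have n2X n : nrm (a / 2 ^+ n) = nrm a / 2 ^+ n.
  by rewrite nrmM nrmV nrmX nrm_nat.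
(* The corners move by at most [nrm a / 2 ^+ n]; the resulting rate [4 * nrm a / 2 ^+ n] is the
   distance allowed in [square_sum_local], and [e / 24] below absorbs its constant. *)
have [n|p pP] := @geometric_cvgC (fun n => (s n).1) (nrm a).
  have [h _] := nxP _ (sP n); move: h.
  by rewrite s2 n2X.
have [L uL] := ud p.
have [d d0 dP] := uL (e / 24) (divr_gt0 e0 (ltr0Sn _ _)).
have [n nd] : exists n, 6 * (nrm a / 2 ^+ n) < d.
  have b0 : 0 <= 6 * nrm a / d by rewrite divr_ge0 ?mulr_ge0 ?nrm_ge0 // ltW.
  have [k kP] : exists k : nat, 6 * nrm a / d < k%:R.
    by exists (Num.bound (6 * nrm a / d)); exact: archi_boundP.
  exists k; rewrite mulrA ltr_pdivrMr ?exprn_gt0 //.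
  rewrite ltr_pdivrMr // in kP; rewrite (lt_trans kP) // mulrC ltr_pM2l //.
  by rewrite -natrX ltr_nat ltn_expl.
apply: (sP n); exists 0%N => m _; rewrite s2.
have -> : e * nrm (a / 2 ^+ n) ^+ 2 = 24 * (e / 24) * nrm (a / 2 ^+ n) ^+ 2.
  by field.
apply: (square_sum_local (p := p) (L := L) (d := d)).
- exact: dP.
- by rewrite ltW // divr_gt0.
- by rewrite n2X mulrA; exact: pP.
- by rewrite n2X.
Qed.

End Goursat.

Section CauchyEstimate.
Context {R : realType}.
Local Notation C := (Cplx R).

Lemma nrm_pi_i : nrm (pi_i R) = pi.
Proof.
have -> : pi_i R = ('i%C : C) * (pi%:C%C : C).
  by apply/eqP; rewrite eq_complex /=; apply/andP; split; apply/eqP; ring.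
by rewrite nrmM nrm_i mul1r nrm_real ger0_norm // pi_ge0.
Qed.

Lemma cexp_2pi_i (z : C) : cexp (z + 2 * pi_i R) = cexp z.
Proof. by rewrite mulr_natl mulr2n !cexpD cexp_pi_i mulrN1 opprK mulr1. Qed.

Lemma derive_scale (phi : C -> C) (z L : C) : differentiable phi z ->
  'D_L phi z = L * 'D_1 phi z.
Proof.
by move=> df; rewrite !deriveE // -[L in LHS]mulr1 -[L * 1]/(L *: 1) linearZ.
Qed.

Lemma differentiable_has_derivative (phi : C -> C) z : differentiable phi z ->
  has_diff phi z ( *%R ('D_1 phi z)).
Proof.
move=> df e /(differentiable_has_diff df) [d d0 dP]; exists d => // H /dP.
by rewrite derive_scale // mulrC.
Qed.

(* The function [u] below has period [2 pi i], so that the horizontal sides of a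
   square of side [2 pi] cancel and the sums over its vertical sides agree in the
   limit.  The vertical line [Re w = 0] is mapped by [cexp] to the unit circle,
   and [u w] tends to the derivative of [phi] at [0] as [Re w] tends to
   [-oo]. *)
Lemma cauchy_estimate (phi : C -> C) B :
  (forall z, differentiable phi z) ->
  (forall z, nrm z <= 1 -> nrm (phi z) <= B) ->
  nrm ('D_1 phi 0) <= 2 * B.
Proof.
move=> dphi phiB.
pose u (w : C) := (phi (cexp w) - phi 0) * cexp (- w).
pose T : C := 2 * pi_i R.
have ud w : exists L, has_diff u w ( *%R L).
  exists ('D_1 u w); apply: differentiable_has_derivative.
  have -> : u = (phi \o (@cexp R) - cst (phi 0)) * (@cexp R \o -%R) by [].
  have dexp z : differentiable (@cexp R : C -> C) z.
    by have [] := is_diff_cexp z.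
  apply: differentiableM; first apply: differentiableB => //.
    exact: differentiable_comp.
  by apply: differentiable_comp.
have uT w : u (w + T) = u w.
  by rewrite /u !cexpN cexp_2pi_i.
(* [c k] is the foot of the [k]-th vertical side; consecutive sides bound a square of side
   [2 * pi]. *)
pose c k : C := - ((2 * pi * k%:R)%:C%C : C).
pose V m k := trapezoid u m (c k) T.
have nT : nrm T = 2 * pi by rewrite nrmM nrm_nat nrm_pi_i.
have pi0 : 0 < pi :> R by exact: pi_gt0.
have VS k e : 0 < e -> exists m0, forall m, (m0 <= m)%N -> nrm (V m k - V m k.+1) <= e.
  move=> e0; pose a : C := (2 * pi)%:C%C.
  have na : nrm a = 2 * pi by rewrite nrm_real ger0_norm // mulr_ge0 // ltW.
  have na0 : 0 < nrm a ^+ 2 by rewrite na exprn_gt0 // mulr_gt0.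
  have [m0 m0P] := goursat (c k.+1) a ud (divr_gt0 e0 na0).
  exists m0 => m /m0P; rewrite divfK ?gt_eqF //.
  rewrite /square_sum.
  have ia : ('i%C : C) * a = T.
    rewrite /a /T /pi_i; apply/eqP; rewrite eq_complex /=.
    by apply/andP; split; apply/eqP; ring.
  rewrite ia (trapezoid_periodic _ _ _ uT).
  have -> : c k.+1 + a = c k.
    by rewrite /c /a -natr1 !(rmorphM, rmorphD) /= rmorph1; ring.
  by rewrite -/(V m k) -/(V m k.+1) [X in X - V m k.+1]addrAC subrr add0r.
have V0 k e : 0 < e -> exists m0, forall m, (m0 <= m)%N -> nrm (V m 0 - V m k) <= e.
  elim: k e => [|k IH] e e0; first by exists 0%N => m _; rewrite subrr nrm0 ltW.
  have e2 : 0 < e / 2 by rewrite divr_gt0.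
  have [m1 h1] := IH _ e2; have [m2 h2] := VS k _ e2.
  exists (m1 + m2)%N => m mm.
  have -> : V m 0 - V m k.+1 = (V m 0 - V m k) + (V m k - V m k.+1) by ring.
  rewrite (le_trans (nrmD _ _)) // [leRHS]splitr lerD //.
    by apply: h1; rewrite (leq_trans _ mm) // leq_addr.
  by apply: h2; rewrite (leq_trans _ mm) // leq_addl.
have ReT (t : R) k : complex.Re (c k + (t%:C%C : C) * T) = - (2 * pi * k%:R).
  by rewrite /c /T /pi_i /=; ring.
have VB m : nrm (V m 0) <= 2 * B * (2 * pi).
  rewrite -nT; apply: trapezoid_bound => t _.
  rewrite /u nrmM cexpN nrmV nrm_cexp ReT mulr0 oppr0 expR0 invr1 mulr1.
  rewrite (le_trans (nrmB _ _)) // mulr_natl mulr2n lerD //.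
    by apply: phiB; rewrite nrm_cexp ReT mulr0 oppr0 expR0.
  by apply: phiB; rewrite nrm0.
set D := 'D_1 phi 0.
have Vlim e : 0 < e -> exists k, forall m, nrm (V m k - D * T) <= e * (2 * pi).
  move=> e0; have [d d0 dP] := differentiable_has_derivative (dphi 0) e0.
  have [k kd] : exists k : nat, expR (- (2 * pi * k%:R)) < d.
    have [k kP] : exists k : nat, d^-1 < k%:R.
      by exists (Num.bound d^-1); apply: archi_boundP; rewrite invr_ge0 ltW.
    exists k; rewrite expRN invf_plt ?posrE ?expR_gt0 //.
    apply: lt_le_trans kP _; apply: le_trans _ (expR_ge1Dx _).
    have : 2 <= pi :> R by exact: pi_ge2.
    have : 0 <= k%:R :> R by []; nra.
  exists k => m.
  (* The constant [D] is written as an affine function so that [trapezoid_affine] evaluates its sum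
     as [D * T]. *)
  have -> : V m k - D * T = trapezoid (fun w => u w - (D + 0 * w)) m (c k) T.
    by rewrite trapezoidB trapezoid_affine mul0r addr0.
  rewrite -nT; apply: trapezoid_bound => t _; set w := c k + _.
  have wk : nrm (cexp w) < d by rewrite nrm_cexp ReT.
  have w0 : 0 < nrm (cexp w) by rewrite nrm_cexp expR_gt0.
  have := dP _ wk; rewrite add0r.
  have -> : u w - (D + 0 * w) = (phi (cexp w) - phi 0 - D * cexp w) / cexp w.
    by rewrite /u cexpN; field; exact: cexp_neq0.
  by rewrite nrmM nrmV ler_pdivrMr.
(* [Vlim] holds at every level, so [k] is fixed first, and then a level [m] at which the first and
   the [k]-th side differ by at most [e]. *)
have fin e : 0 < e -> nrm D * (2 * pi) <= 2 * B * (2 * pi) + (e + e * (2 * pi)).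
  move=> e0; have [k kP] := Vlim _ e0; have [m /(_ m (leqnn _)) mP] := V0 k _ e0.
  have -> : nrm D * (2 * pi) = nrm (V m 0 - ((V m 0 - V m k) + (V m k - D * T))).
    by rewrite -nT -nrmM; congr nrm; ring.
  rewrite (le_trans (nrmB _ _)) // lerD //.
  by rewrite (le_trans (nrmD _ _)) // lerD.
have pi20 : 0 < 2 * pi :> R by rewrite mulr_gt0.
rewrite -(ler_pM2r pi20); apply/ler_addgt0Pr => e e0.
have p1 : 0 < 1 + 2 * pi :> R by rewrite addr_gt0.
have := fin _ (divr_gt0 e0 p1).
suff -> : e / (1 + 2 * pi) + e / (1 + 2 * pi) * (2 * pi) = e by [].
by rewrite -[X in X + _]mulr1 -mulrDr divfK // gt_eqF.
Qed.

End CauchyEstimate.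

(** * Derivatives of entire functions *)

Section MeanValue.
Context {R : realType}.
Local Notation C := (Cplx R).

Lemma is_derive_real (f : R -> R) (x d : R) :
  (forall e : R, 0 < e -> exists2 r : R, 0 < r &
    forall t, `|t| < r -> `|f (x + t) - f x - d * t| <= e * `|t|) ->
  is_derive x 1 f d.
Proof.
move=> fd.
have fcvg : (fun h => h^-1 *: ((f \o shift x) (h *: 1) - f x)) @ 0^' --> d.
  apply/cvgrPdist_le => e e0; have [r r0 rP] := fd _ e0.
  apply/nbhs_ballP; exists r => //= t; rewrite -ball_normE /= sub0r normrN => tr t0.
  have tn0 : 0 < `|t| by rewrite normr_gt0.
  rewrite -(ler_pM2r tn0) -normrM; apply: le_trans (rP t tr).
  rewrite -normrN.
  suff -> : - ((d - t^-1 *: (f (t *: 1 + x) - f x)) * t) = f (x + t) - f x - d * t by [].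
  rewrite [t *: 1]mulr1 [t + x]addrC -[_ *: _]/(_ * _); field.
  by rewrite t0.
apply: DeriveDef; first by apply/cvg_ex; exists d.
exact: cvg_lim fcvg.
Qed.

(** The mean value theorem holds for real values only. [p] stands for the real or the imaginary
    part, and adding the two bounds gives the factor 2 of [mean_value]. *)
Lemma mvt_part (p : C -> R) (phi : C -> C) K :
  (forall z w, p (z - w) = p z - p w) ->
  (forall z (r : R), p (z * (r%:C%C : C)) = p z * r) ->
  (forall z, `|p z| <= nrm z) ->
  (forall z, differentiable phi z) ->
  (forall t : R, 0 <= t <= 1 -> nrm ('D_1 phi (t%:C%C : C)) <= K) ->
  `|p (phi 1 - phi 0)| <= K.
Proof.
move=> pB pZ pn dphi phiK.
pose psi (t : R) := p (phi (t%:C%C : C)).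
have dpsi (t : R) : is_derive t 1 psi (p ('D_1 phi (t%:C%C : C))).
  apply: is_derive_real => e e0.
  have [d d0 dP] := differentiable_has_derivative (dphi (t%:C%C : C)) e0.
  exists d => // r rd; rewrite /psi -pZ -!pB (le_trans (pn _)) //.
  by rewrite rmorphD -(nrm_real r); apply: dP; rewrite nrm_real.
have cpsi : {within `[0 : R, 1], continuous psi}.
  apply: continuous_subspaceT => t; apply: differentiable_continuous.
  by apply/derivable1_diffP; exact: ex_derive.
have [c] := MVT ltr01 (fun t _ => dpsi t) cpsi.
rewrite in_itv /= subr0 mulr1 /psi -pB => /andP[c0 c1] ->.
by rewrite (le_trans (pn _)) // phiK // (ltW c0) ltW.
Qed.

Lemma mean_value (phi : C -> C) K :
  (forall z, differentiable phi z) ->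
  (forall t : R, 0 <= t <= 1 -> nrm ('D_1 phi (t%:C%C : C)) <= K) ->
  nrm (phi 1 - phi 0) <= 2 * K.
Proof.
move=> dphi phiK; apply: le_trans (nrm_ReIm _) _; rewrite mulr_natl mulr2n.
apply: lerD; apply: (@mvt_part _ phi) => //.
- by move=> [? ?] [? ?].
- by move=> [? ?] ? /=; rewrite mulr0 subr0.
- exact: nrm_Re.
- by move=> [? ?] [? ?].
- by move=> [? ?] ? /=; rewrite mulr0 add0r.
- exact: nrm_Im.
Qed.

End MeanValue.

Section DirectionalDerivatives.
Context {R : realType} {V : normedModType (Cplx R)}.
Local Notation C := (Cplx R).
Implicit Types (f : V -> C) (W v H X Y : V).

Lemma differentiable_line f W v : (forall X, differentiable f X) ->
  forall z : C, differentiable (fun t : C => f (W + t *: v)) z.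
Proof.
move=> df z; have -> : (fun t : C => f (W + t *: v)) = f \o (cst W + ( *:%R^~ v)) by [].
apply: differentiable_comp => //; apply: differentiableD.
Qed.

Lemma derive_line f W v (z : C) :
  'D_1 (fun t : C => f (W + t *: v)) z = 'D_v f (W + z *: v).
Proof.
rewrite /derive.
suff -> : (fun t : C => t^-1 *: (((fun s : C => f (W + s *: v)) \o shift z) (t *: 1)
     - f (W + z *: v))) =
   (fun t : C => t^-1 *: ((f \o shift (W + z *: v)) (t *: v) - f (W + z *: v))) by [].
by apply/funext => t /=; rewrite [t *: 1]mulr1 scalerDl addrCA.
Qed.

Lemma derive_translate f H W v : 'D_v (fun X => f (X + H)) W = 'D_v f (W + H).
Proof.
rewrite /derive.
suff -> : (fun t : C => t^-1 *: (((fun X => f (X + H)) \o shift W) (t *: v)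
     - f (W + H))) =
   (fun t : C => t^-1 *: ((f \o shift (W + H)) (t *: v) - f (W + H))) by [].
by apply/funext => t /=; rewrite addrA.
Qed.

Lemma deriveZv f W v (c : C) : differentiable f W ->
  'D_(c *: v) f W = c * 'D_v f W.
Proof. by move=> df; rewrite !deriveE // linearZ. Qed.

Lemma differentiable_translate f H : (forall X, differentiable f X) ->
  forall X, differentiable (fun Y => f (Y + H)) X.
Proof.
move=> df X; have -> : (fun Y => f (Y + H)) = f \o (id + cst H) by [].
by apply: differentiable_comp => //; apply: differentiableD.
Qed.

Lemma cauchy_estimate_ball f (W0 : V) r B : (forall X, differentiable f X) ->
  0 < r -> (forall X, nrm (X - W0) < r -> nrm (f X) <= B) ->
  forall W v, nrm (W - W0) < r / 2 -> nrm ('D_v f W) <= 8 * B / r * nrm v.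
Proof.
move=> df r0 fB W v WW0.
have [v0|v0] := eqVneq v 0; first by rewrite v0 derive0 !nrm0 mulr0.
have nv : 0 < nrm v.
  rewrite lt_neqAle nrm_ge0 andbT; apply: contra_neq v0 => h.
  exact: nrm0_eq0.
(* With this scale the unit disc in direction [s v] has radius [r / 4] and stays within
   [r / 2 + r / 4 < r] of [W0]. *)
pose s := r / (4 * nrm v); have s0 : 0 < s by rewrite divr_gt0 // mulr_gt0.
have sv : s * nrm v = r / 4 by rewrite /s; field; rewrite gt_eqF.
have := @cauchy_estimate R (fun t => f (W + t *: ((s%:C%C : C) *: v))) B.
rewrite derive_line scale0r addr0 deriveZv // nrmM nrm_real ger0_norm ?(ltW s0) //.
have h1 : forall z : C, differentiable (fun t : C => f (W + t *: ((s%:C%C : C) *: v))) z.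
  exact: differentiable_line.
move=> /(_ h1) h.
have : s * nrm ('D_v f W) <= 2 * B.
  apply: h => z z1; apply: fB.
  rewrite addrAC (le_lt_trans (nrmD _ _)) // !nrmZ nrm_real ger0_norm ?(ltW s0) //.
  rewrite sv; have : nrm z * (r / 4) <= r / 4 by rewrite ler_piMl // divr_ge0 // ltW.
  lra.
have -> : 8 * B / r * nrm v = 2 * B / s.
  by rewrite /s; field; rewrite !gt_eqF.
by rewrite ler_pdivlMr // mulrC.
Qed.

Lemma mean_value_line f W H K : (forall X, differentiable f X) ->
  (forall t : R, 0 <= t <= 1 -> nrm ('D_H f (W + (t%:C%C : C) *: H)) <= K) ->
  nrm (f (W + H) - f W) <= 2 * K.
Proof.
move=> df fK.
have := @mean_value R (fun t => f (W + t *: H)) K (differentiable_line W H df).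
rewrite scale1r scale0r addr0; apply=> t t01.
by rewrite derive_line fK.
Qed.

End DirectionalDerivatives.

Section EntireDerivative.
Context {R : realType} {V : normedModType (Cplx R)}.
Local Notation C := (Cplx R).
Implicit Types (f G : V -> C) (W v H X Y : V).

Lemma locally_bounded f W : differentiable f W ->
  exists2 r : R, 0 < r & exists B : R, 0 <= B /\
    forall X, nrm (X - W) < r -> nrm (f X) <= B.
Proof.
move=> df; have fc := differentiable_continuous df.
have /nbhs_nrmP [r r0 rP] : nbhs W [set X | `|f W - f X| < 1].
  by move/cvgrPdist_lt : fc => /(_ _ ltr01).
exists r => //; exists (nrm (f W) + 1); split.
  by rewrite addr_ge0 // nrm_ge0.
move=> X /rP /=; rewrite nrmE -[1]/(1%:C%C) ltcR => h.
have -> : f X = f W - (f W - f X) by rewrite opprB addrC subrK.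
by rewrite (le_trans (nrmB _ _)) // lerD // ltW.
Qed.

(** Cauchy's estimate bounds the derivatives, so by the mean value inequality the increment
    [f (X + H) - f X] is at most a constant times [nrm H]. Cauchy's estimate for this increment, as
    a function of [X], bounds the increment of the derivative. *)
Lemma derive_lipschitz f W0 : (forall X, differentiable f X) ->
  exists2 r : R, 0 < r & exists K : R, [/\ 0 <= K,
    forall X v, nrm (X - W0) < r -> nrm ('D_v f X) <= K * nrm v &
    forall X H v, nrm (X - W0) < r -> nrm H < r ->
      nrm ('D_v f (X + H) - 'D_v f X) <= K * nrm H * nrm v].
Proof.
move=> df; have [r r0 [B [B0 fB]]] := locally_bounded (df W0).
have K0 : 0 <= 8 * B / r by rewrite divr_ge0 ?mulr_ge0 // ltW.
have r4 : 0 < r / 4 by rewrite divr_gt0.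
have d1 := cauchy_estimate_ball df r0 fB.
(* Two radii of [r / 4] keep the segment from [X] to [X + H] inside the ball of radius [r / 2] where
   [d1] applies. The second use of Cauchy's estimate halves [r / 4] once more. *)
have lip X H : nrm (X - W0) < r / 4 -> nrm H < r / 4 ->
    nrm (f (X + H) - f X) <= 2 * (8 * B / r * nrm H).
  move=> Xr Hr; apply: mean_value_line => // t /andP[t0 t1]; apply: d1.
  rewrite addrAC (le_lt_trans (nrmD _ _)) // nrmZ nrm_real ger0_norm //.
  have : t * nrm H <= nrm H by rewrite ler_piMl // nrm_ge0.
  lra.
exists (r / 8); first by rewrite divr_gt0.
pose K1 := 8 * B / r; pose K2 := 8 * (2 * K1) / (r / 4).
have K20 : 0 <= K2.
  by apply: divr_ge0; [do 2 apply: mulr_ge0 => //|exact: ltW].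
exists (K1 + K2); split; first by rewrite addr_ge0.
  move=> X v Xr; have hX : nrm (X - W0) < r / 2 by lra.
  rewrite (le_trans (d1 _ _ hX)) // ler_wpM2r ?nrm_ge0 //.
  by rewrite lerDl.
move=> X H v Xr Hr.
have dF : forall Y, differentiable (fun Y => f (Y + H) - f Y) Y.
  by move=> Y; apply: differentiableB => //; apply: differentiable_translate.
have FB Y : nrm (Y - W0) < r / 4 -> nrm (f (Y + H) - f Y) <= 2 * (K1 * nrm H).
  by move=> Yr; apply: lip => //; lra.
have Xr4 : nrm (X - W0) < r / 4 / 2 by lra.
have := cauchy_estimate_ball dF r4 FB v Xr4.
rewrite deriveB; last 2 first.
- by apply: diff_derivable; exact: differentiable_translate.
- exact: diff_derivable.
rewrite derive_translate => /le_trans; apply.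
rewrite ler_wpM2r ?nrm_ge0 //.
have -> : 8 * (2 * (K1 * nrm H)) / (r / 4) = K2 * nrm H.
  by rewrite /K2; field; rewrite gt_eqF.
by rewrite ler_wpM2r ?nrm_ge0 // lerDr.
Qed.

(** Mean value inequality for [f (X + t H)] minus its linear part in [t]: the derivative is an
    increment of ['D_H f], hence of order [nrm H ^+ 2] by the Lipschitz bound. *)
Lemma taylor1 f W0 : (forall X, differentiable f X) ->
  exists2 r : R, 0 < r & exists2 K : R, 0 <= K &
    forall X H, nrm (X - W0) < r -> nrm H < r ->
      nrm (f (X + H) - f X - 'D_H f X) <= K * nrm H ^+ 2.
Proof.
move=> df; have [r r0 [K [K0 _ lip]]] := derive_lipschitz W0 df.
exists r => //; exists (2 * K); first by rewrite mulr_ge0.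
move=> X H Xr Hr.
pose phi (t : C) := f (X + t *: H) - 'D_H f X * t.
have dl (t : C) : differentiable (fun s : C => 'D_H f X * s) t.
  by apply: differentiableZ.
have dphi (t : C) : differentiable phi t.
  by apply: differentiableB => //; exact: differentiable_line.
have := @mean_value R phi (K * nrm H * nrm H) dphi.
rewrite /phi scale1r scale0r addr0 mulr1 mulr0 subr0.
have -> : f (X + H) - 'D_H f X - f X = f (X + H) - f X - 'D_H f X by ring.
have -> : 2 * (K * nrm H * nrm H) = 2 * K * nrm H ^+ 2 by ring.
apply=> t /andP[t0 t1].
rewrite deriveB; last 2 first.
- by apply: diff_derivable; exact: differentiable_line.
- exact: diff_derivable.
rewrite derive_line deriveMl // derive_id.
rewrite mulr1.
have tH : nrm ((t%:C%C : C) *: H) <= nrm H.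
  by rewrite nrmZ nrm_real ger0_norm // ler_piMl // nrm_ge0.
rewrite (le_trans (lip _ _ _ Xr (le_lt_trans tH Hr))) //.
by rewrite ler_wpM2r ?nrm_ge0 // ler_wpM2l.
Qed.

(** [G] respects linear relations between small vectors up to a quadratic error. Three terms are
    what additivity and scaling together require; shorter relations take [H3 = 0]. *)
Definition quadratic_increments (G : V -> C) (r K : R) :=
  (forall H, nrm H < r -> nrm (G H) <= K * nrm H) /\
  (forall (a b c : C) H1 H2 H3, nrm H1 < r -> nrm H2 < r -> nrm H3 < r ->
     a *: H1 + b *: H2 + c *: H3 = 0 ->
     nrm (a * G H1 + b * G H2 + c * G H3) <=
     K * (nrm a * nrm H1 ^+ 2 + nrm b * nrm H2 ^+ 2 + nrm c * nrm H3 ^+ 2)).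

(* Cauchy's estimate, applied to the function
   [a (f (X + H1) - f X) + b (f (X + H2) - f X) + c (f (X + H3) - f X)] of [X],
   whose first order part vanishes. *)
Lemma derive_quadratic_increments f v W0 : (forall X, differentiable f X) ->
  exists2 r : R, 0 < r & exists2 K : R, 0 <= K &
    quadratic_increments (fun H => 'D_v f (W0 + H) - 'D_v f W0) r K.
Proof.
move=> df; have [r1 r10 [K1 [K10 _ lip]]] := derive_lipschitz W0 df.
have [r2 r20 [K2 K20 tay]] := taylor1 W0 df.
have W00 : nrm (W0 - W0) = 0 by rewrite subrr nrm0.
exists (Num.min r1 r2); first by rewrite lt_min r10.
have c0 : 0 <= 8 * K2 / r2 by rewrite divr_ge0 ?mulr_ge0 // ltW.
exists ((K1 + 8 * K2 / r2) * (nrm v)).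
  by rewrite mulr_ge0 ?nrm_ge0 // addr_ge0.
split=> [H|a b c H1 H2 H3]; rewrite !lt_min.
  move=> /andP[Hr _]; have h0 : nrm (W0 - W0) < r1 by rewrite W00.
  rewrite (le_trans (lip _ _ _ h0 Hr)) // mulrAC ler_wpM2r ?nrm_ge0 //.
  by rewrite ler_wpM2r ?nrm_ge0 // lerDl.
move=> /andP[_ Hr1] /andP[_ Hr2] /andP[_ Hr3] abc.
set S := nrm a * _ + _ + _.
have S0 : 0 <= S by rewrite !addr_ge0 // mulr_ge0 ?nrm_ge0 // exprn_ge0 ?nrm_ge0.
pose d H X := f (X + H) - f X.
have dd H X : differentiable (d H) X.
  by apply: differentiableB => //; exact: differentiable_translate.
have Dd H : 'D_v (d H) W0 = 'D_v f (W0 + H) - 'D_v f W0.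
  rewrite deriveB; last 2 first.
  - by apply: diff_derivable; exact: differentiable_translate.
  - exact: diff_derivable.
  by rewrite derive_translate.
pose F := a *: d H1 + b *: d H2 + c *: d H3.
have dF X : differentiable F X.
  by apply: differentiableD; [apply: differentiableD|]; exact: differentiableZ.
have DF : 'D_v F W0 = a * 'D_v (d H1) W0 + b * 'D_v (d H2) W0 + c * 'D_v (d H3) W0.
  have dv H : derivable (d H) W0 v by exact: diff_derivable.
  have dZ (e : C) H : derivable (e *: d H) W0 v by exact: derivableZ.
  have E1 := deriveD (dZ a H1) (dZ b H2).
  have E2 := deriveD (derivableD (dZ a H1) (dZ b H2)) (dZ c H3).
  by rewrite /F E2 E1 (deriveZ _ (dv H1)) (deriveZ _ (dv H2)) (deriveZ _ (dv H3)).
have FB X : nrm (X - W0) < r2 -> nrm (F X) <= K2 * S.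
  move=> Xr; have lin : a * 'D_H1 f X + b * 'D_H2 f X + c * 'D_H3 f X = 0.
    rewrite !deriveE // -[a * _]/(a *: _) -[b * _]/(b *: _) -[c * _]/(c *: _).
    by rewrite -!linearZ -!linearD abc linear0.
  have -> : F X = a * (d H1 X - 'D_H1 f X) + b * (d H2 X - 'D_H2 f X)
      + c * (d H3 X - 'D_H3 f X).
    have FE : F X = a * d H1 X + b * d H2 X + c * d H3 X by [].
    rewrite -[LHS]subr0 -lin FE.
    move: (d H1 X) (d H2 X) (d H3 X) ('D_H1 f X) ('D_H2 f X) ('D_H3 f X) => *.
    ring.
  have T (e : C) H : nrm H < r2 -> nrm (e * (d H X - 'D_H f X)) <= K2 * (nrm e * nrm H ^+ 2).
    by move=> Hr; rewrite nrmM mulrCA ler_wpM2l ?nrm_ge0 // tay.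
  rewrite /S [leRHS]mulrDr [K2 * (_ + _)]mulrDr.
  apply: le_trans (nrmD _ _) _; apply: lerD; last exact: T.
  by apply: le_trans (nrmD _ _) _; apply: lerD; exact: T.
have h0 : nrm (W0 - W0) < r2 / 2 by rewrite W00 divr_gt0.
have := cauchy_estimate_ball dF r20 FB v h0.
rewrite DF !Dd => /le_trans; apply.
have -> : 8 * (K2 * S) / r2 * nrm v = (8 * K2 / r2) * nrm v * S.
  by field; rewrite gt_eqF.
by rewrite ler_wpM2r // ler_wpM2r ?nrm_ge0 // lerDr.
Qed.

End EntireDerivative.

(** * Linear approximation of functions that are linear up to quadratic errors *)

Section QuadraticIncrements.
Context {R : realType} {V : normedModType (Cplx R)}.
Local Notation C := (Cplx R).
Variables (G : V -> C) (r K : R).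
Hypotheses (r0 : 0 < r) (K0 : 0 <= K) (GK : quadratic_increments G r K).

Let nrm_half n : nrm ((2 ^+ n)^-1 : C) = (2 ^+ n)^-1.
Proof. by rewrite nrmV nrmX nrm_nat. Qed.

Let ler_addeps (x c : R) : (forall e : R, 0 < e -> x <= c + e) -> x <= c.
Proof. by move=> h; apply/ler_addgt0Pr. Qed.

(* The limit [l] is that of [2 ^ n * G (H / 2 ^ n)]. *)
Lemma quadratic_increments_lim_small H : nrm H < r ->
  exists l, forall t : C, nrm (t *: H) < r ->
    nrm (G (t *: H) - t * l) <= K * nrm (t *: H) ^+ 2.
Proof.
move=> Hr; pose s n : C := (2 ^+ n)^-1.
pose q := K * nrm H ^+ 2.
have q0 : 0 <= q by rewrite mulr_ge0 // exprn_ge0 // nrm_ge0.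
have sr n : nrm (s n *: H) < r.
  rewrite nrmZ nrm_half (le_lt_trans _ Hr) // ler_piMl ?nrm_ge0 //.
  by rewrite invf_le1 ?exprn_gt0 // -natrX ler1n expn_gt0.
have ns n : nrm (s n) = (2 ^+ n)^-1 by exact: nrm_half.
have nsV n : nrm (s n)^-1 = 2 ^+ n by rewrite nrmV ns invrK.
have s0 n : s n != 0 by rewrite invr_neq0 // expf_neq0.
have r2 n : (2 ^+ n : R) != 0 by rewrite expf_neq0.
have H0r : nrm (0 : V) < r by rewrite nrm0.
have [n|l lP] := @geometric_cvgC R (fun n => (s n)^-1 * G (s n *: H)) (2 * q).
  have := GK.2 (s n.+1)^-1 (- (s n)^-1) 0 _ _ _ (sr n.+1) (sr n) H0r.
  rewrite mul0r addr0 scale0r addr0 !scalerA mulNr !mulVf // scale1r scaleNr scale1r subrr.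
  move=> /(_ erefl); rewrite mulNr nrm0 expr0n mulr0 addr0 nrmN => /le_trans; apply.
  rewrite !nrmZ !nsV !ns !exprMn.
  rewrite exprS; have := r2 n; set x := 2 ^+ n => x0.
  have x0' : 0 < x by rewrite exprn_gt0.
  have -> : K * (2 * x * ((2 * x)^-1 ^+ 2 * nrm H ^+ 2) + x * (x^-1 ^+ 2 * nrm H ^+ 2)) =
    (3 / 2) * q / x by rewrite /q; field.
  rewrite ler_wpM2r ?invr_ge0 ?(ltW x0') // ler_wpM2r //.
  by rewrite ler_pdivrMr //; lra.
exists l => t tr; apply: ler_addeps => e e0.
(* The total error is [nrm t * (9 * q) / 2 ^+ n]: [4 * (2 * q)] from the rate of convergence to [l],
   and [q] from comparing [t *: H] with [s n *: H]. *)
have c0 : 0 <= nrm t * (9 * q) / e.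
  by rewrite divr_ge0 ?(ltW e0) // !mulr_ge0 // nrm_ge0.
pose n := Num.bound (nrm t * (9 * q) / e).
have nP : nrm t * (9 * q) / 2 ^+ n <= e.
  rewrite ler_pdivrMr ?exprn_gt0 // [e * _]mulrC -ler_pdivrMr //.
  apply: ltW; apply: lt_trans (archi_boundP c0) _.
  by rewrite -natrX ltr_nat ltn_expl.
have := GK.2 1 (- (t / s n)) 0 _ _ _ tr (sr n) H0r.
rewrite mul0r addr0 scale0r addr0 scale1r scaleNr scalerA divfK // subrr.
move=> /(_ erefl); rewrite mul1r mulNr nrm0 expr0n mulr0 addr0 nrmN nrm1 mul1r => h1.
have h2 := lP n.
have -> : G (t *: H) - t * l = (G (t *: H) - t / s n * G (s n *: H))
    + t * ((s n)^-1 * G (s n *: H) - l) by ring.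
have h3 : nrm (t * ((s n)^-1 * G (s n *: H) - l)) <= nrm t * (4 * (2 * q) / 2 ^+ n).
  by rewrite nrmM ler_wpM2l ?nrm_ge0.
apply: le_trans (nrmD _ _) _; apply: le_trans (lerD h1 h3) _.
rewrite [K * _]mulrDr -addrA lerD2l; apply: le_trans _ nP.
rewrite nrmM nrmZ nsV ns exprMn; have := r2 n; set x := 2 ^+ n => x0.
suff -> : K * (nrm t * x * (x^-1 ^+ 2 * nrm H ^+ 2)) + nrm t * (4 * (2 * q) / x) =
  nrm t * (9 * q) / x by [].
by rewrite /q; field.
Qed.

Lemma quadratic_increments_lim H : exists l, forall t : C, nrm (t *: H) < r ->
    nrm (G (t *: H) - t * l) <= K * nrm (t *: H) ^+ 2.
Proof.
have n1 : 0 < nrm H + 1 by rewrite (lt_le_trans ltr01) // lerDr nrm_ge0.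
pose s := r / (nrm H + 1); have s0 : 0 < s by rewrite divr_gt0.
have sC : (s%:C%C : C) != 0 by rewrite -(rmorph0 (real_complex R)) (inj_eq (@complexI R)) gt_eqF.
have [|l lP] := @quadratic_increments_lim_small ((s%:C%C : C) *: H).
  rewrite nrmZ nrm_real gtr0_norm // /s mulrAC ltr_pdivrMr // ltr_pM2l //.
  by rewrite ltrDl.
exists (l / (s%:C%C : C)) => t.
have -> : t *: H = (t / (s%:C%C : C)) *: ((s%:C%C : C) *: H).
  by rewrite scalerA divfK.
move=> /lP; suff -> : t / (s%:C%C : C) * l = t * (l / (s%:C%C : C)) by [].
by rewrite mulrAC mulrA.
Qed.

(** The linearity defect [x] of the pointwise limits scales like [t], while the relation satisfied
    by [G] bounds it by a multiple of [t ^+ 2]; letting [t] tend to 0 gives [x = 0]. *)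
Lemma quadratic_increments_linear : exists L : {linear V -> C},
  continuous L /\ forall H, nrm H < r -> nrm (G H - L H) <= K * nrm H ^+ 2.
Proof.
have [L LP] := choice quadratic_increments_lim.
have L1 H : nrm H < r -> nrm (G H - L H) <= K * nrm H ^+ 2.
  by have := LP H 1; rewrite scale1r mul1r.
have Llin : linear L.
  move=> a H H'; apply/eqP; rewrite -subr_eq0; apply/eqP; apply: nrm0_eq0.
  set X := a *: H + H'; set x := L X - _.
  apply/eqP; rewrite eq_le nrm_ge0 andbT.
  (* Half of [c] accounts for the error in the relation for [G], the other half for the three
     differences between [G] and [L]. *)
  pose c := 2 * K * (nrm X ^+ 2 + nrm a * nrm H ^+ 2 + nrm H' ^+ 2).
  have c0 : 0 <= c.
    by rewrite !mulr_ge0 // !addr_ge0 ?mulr_ge0 ?exprn_ge0 // nrm_ge0.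
  pose M := nrm X + nrm H + nrm H' + 1.
  have M0 : 0 < M by rewrite ltr_pwDr // !addr_ge0 // nrm_ge0.
  apply: ler_addeps => e e0; rewrite add0r.
  (* The first bound gives [t * c <= e], the second keeps the three scaled vectors in the ball of
     radius [r]. *)
  pose t := Num.min (e / (c + 1)) (r / M).
  have c1 : 0 < c + 1 by rewrite ltr_pwDr.
  have t0 : 0 < t by rewrite lt_min !divr_gt0.
  have tr (Y : V) : nrm Y < M -> nrm ((t%:C%C : C) *: Y) < r.
    move=> YM; rewrite nrmZ nrm_real gtr0_norm //.
    apply: (@le_lt_trans _ _ (r / M * nrm Y)).
      by rewrite ler_wpM2r ?nrm_ge0 // ge_min lexx orbT.
    by rewrite mulrAC ltr_pdivrMr // ltr_pM2l.
  have XM : nrm X < M by have := nrm_ge0 H; have := nrm_ge0 H'; rewrite /M; lra.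
  have HM : nrm H < M by have := nrm_ge0 X; have := nrm_ge0 H'; rewrite /M; lra.
  have HM' : nrm H' < M by have := nrm_ge0 X; have := nrm_ge0 H; rewrite /M; lra.
  have gX := LP _ _ (tr _ XM); have gH := LP _ _ (tr _ HM).
  have gH' := LP _ _ (tr _ HM').
  have := GK.2 1 (- a) (-1) _ _ _ (tr _ XM) (tr _ HM) (tr _ HM').
  have -> : 1 *: ((t%:C%C : C) *: X) + - a *: ((t%:C%C : C) *: H)
      + -1 *: ((t%:C%C : C) *: H') = 0.
    rewrite /X scale1r !scaleNr scale1r scalerDr !scalerA [a * _]mulrC.
    by rewrite addrAC addrK subrr.
  move=> /(_ erefl); rewrite mul1r mulNr mulN1r !nrmN nrm1 !mul1r => h.
  have : nrm ((t%:C%C : C) * x) <= t * (t * c).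
    have -> : (t%:C%C : C) * x =
       (G ((t%:C%C : C) *: X) - a * G ((t%:C%C : C) *: H) - G ((t%:C%C : C) *: H'))
       - (G ((t%:C%C : C) *: X) - (t%:C%C : C) * L X)
       + a * (G ((t%:C%C : C) *: H) - (t%:C%C : C) * L H)
       + (G ((t%:C%C : C) *: H') - (t%:C%C : C) * L H').
      by rewrite /x -[a *: L H]/(a * L H); ring.
    apply: le_trans (nrmD _ _) _; apply: le_trans (lerD (nrmD _ _) gH') _.
    rewrite [nrm (a * _)]nrmM.
    apply: le_trans (lerD (lerD (nrmB _ _) (ler_wpM2l (nrm_ge0 _) gH)) (lexx _)) _.
    apply: le_trans (lerD (lerD (lerD h gX) (lexx _)) (lexx _)) _.
    rewrite !nrmZ nrm_real gtr0_norm // /c.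
    have := nrm_ge0 a; move: (nrm a) (nrm X) (nrm H) (nrm H') => x1 x2 x3 x4 _.
    rewrite le_eqVlt; apply/orP; left; apply/eqP; ring.
  rewrite nrmM nrm_real gtr0_norm // ler_pM2l // => /le_trans; apply.
  apply: (@le_trans _ _ (e / (c + 1) * c)).
    by rewrite ler_wpM2r // ge_min lexx.
  by rewrite mulrAC ler_pdivrMr // ler_pM2l // lerDl.
pose Ll : {linear V -> C} := HB.pack L (GRing.isLinear.Build _ _ _ _ _ Llin).
(* [L] is bounded on the ball of radius [r], because [G] and [G - L] are. *)
exists Ll; split=> //; apply: bounded_linear_continuous.
apply/ex_bound; exists ((K * r + K * r ^+ 2)%:C%C : C).
apply/nbhs_nrmP; exists r => // H; rewrite subr0 => Hr.
rewrite /= nrmE lecR.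
have -> : L H = G H - (G H - L H) by rewrite opprB addrC subrK.
rewrite (le_trans (nrmB _ _)) // lerD //.
  by rewrite (le_trans (GK.1 _ Hr)) // ler_wpM2l // ltW.
rewrite (le_trans (L1 _ Hr)) // ler_wpM2l // lerXn2r ?nnegrE ?nrm_ge0 // ltW //.
Qed.

End QuadraticIncrements.

(** The error [K * nrm H ^+ 2] is small compared with [nrm H], so the linear map found above is the
    derivative of ['D_v f] at [W]. *)
Lemma differentiable_derive (R : realType) (V : normedModType (Cplx R))
    (f : V -> Cplx R) (v : V) :
  (forall W, differentiable f W) -> forall W, differentiable ('D_v f) W.
Proof.
move=> df W; have [r r0 [K K0 GK]] := derive_quadratic_increments v W df.
have [L [Lc LP]] := quadratic_increments_linear r0 K0 GK.
have [] // := @has_diff_differentiable R V ('D_v f) W L Lc.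
move=> e e0; have K1 : 0 < K + 1 by rewrite ltr_pwDr.
exists (Num.min r (e / (K + 1))); first by rewrite lt_min r0 divr_gt0.
move=> H; rewrite lt_min => /andP[Hr He].
rewrite (le_trans (LP H Hr)) // expr2 mulrA ler_wpM2r ?nrm_ge0 //.
rewrite ltr_pdivlMr // in He; have := nrm_ge0 H; nra.
Qed.

(** * Direct sums and graded operators *)

Section SumsOfSubspaces.
Context {K : nzRingType}.

(** The operators are defined on all functions, but derivatives and components behave linearly only
    on suitable subspaces; bundled linear maps would not fit. *)
Definition linear_on (E F : lmodType K) (V : set E) (f : E -> F) : Prop :=
  forall (c : K) x y, V x -> V y -> f (c *: x + y) = c *: f x + f y.

Section LinearOn.
Context {E F : lmodType K}.
Implicit Types (V : set E) (f : E -> F).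

Lemma subspaceD V x y : subspace V -> V x -> V y -> V (x + y).
Proof. by move=> [_ VD] Vx Vy; rewrite -[x]scale1r; exact: VD. Qed.

Lemma subspaceZ V c x : subspace V -> V x -> V (c *: x).
Proof. by move=> [V0 VD] Vx; rewrite -[_ *: _]addr0; exact: VD. Qed.

Lemma subspaceB V x y : subspace V -> V x -> V y -> V (x - y).
Proof.
by move=> VS Vx Vy; apply: subspaceD => //; rewrite -scaleN1r; exact: subspaceZ.
Qed.

Lemma subspace_sum V (J : Type) (s : seq J) (p : pred J) (u : J -> E) : subspace V ->
  (forall j, p j -> V (u j)) -> V (\sum_(j <- s | p j) u j).
Proof.
move=> VS Vu; apply: big_ind => [|x y|//]; first exact: VS.1.
exact: subspaceD.
Qed.

Lemma linear_on0 V f : subspace V -> linear_on V f -> f 0 = 0.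
Proof.
move=> [V0 _] /(_ 1 0 0 V0 V0); rewrite scaler0 addr0 scale1r.
by move=> /(congr1 (fun z => z - f 0)); rewrite subrr addrK.
Qed.

Lemma linear_onD V f x y : linear_on V f -> V x -> V y -> f (x + y) = f x + f y.
Proof. by move=> fl Vx Vy; rewrite -[x]scale1r fl // !scale1r. Qed.

Lemma linear_onB V f x y : subspace V -> linear_on V f -> V x -> V y ->
  f (x - y) = f x - f y.
Proof.
move=> VS fl Vx Vy; rewrite addrC -scaleN1r fl // scaleN1r addrC //.
Qed.

Lemma linear_on_sum V f (I : eqType) (s : seq I) (u : I -> E) :
  subspace V -> linear_on V f -> (forall i, i \in s -> V (u i)) ->
  f (\sum_(i <- s) u i) = \sum_(i <- s) f (u i).
Proof.
move=> VS fl; elim: s => [|i s IH] Vu; first by rewrite !big_nil (linear_on0 VS fl).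
have Vs j : j \in s -> V (u j) by move=> js; apply: Vu; rewrite inE js orbT.
rewrite !big_cons (linear_onD fl (Vu _ (mem_head _ _))) ?IH //.
by rewrite big_seq; apply: (subspace_sum _ VS).
Qed.

Lemma image_subspace V f : subspace V -> linear_on V f -> subspace (f @` V).
Proof.
move=> VS fl; split; first by exists 0; [exact: VS.1|exact: linear_on0 fl].
move=> c _ _ [x Vx <-] [y Vy <-]; exists (c *: x + y); last exact: fl.
exact: VS.2.
Qed.

End LinearOn.

Definition independent (I : choiceType) (E : lmodType K) (P : set I)
    (V : I -> set E) : Prop :=
  forall (s : seq I) (u : I -> E), uniq s ->
    (forall i, i \in s -> P i /\ V i (u i)) ->
    \sum_(i <- s) u i = 0 -> forall i, i \in s -> u i = 0.

Section Decompositions.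
Context {I : choiceType} {E : lmodType K}.
Variables (P : set I) (V : I -> set E).
Hypothesis VS : forall i, P i -> subspace (V i).

Lemma decomposes_support x u (s : seq I) : decomposes P V x u -> uniq s ->
  (forall i, u i != 0 -> i \in s) -> x = \sum_(i <- s) u i.
Proof.
move=> [_ u0 _ ->] su us.
rewrite [RHS]fsbig_seq // [LHS]fsbig_supp [RHS]fsbig_supp.
apply: eq_fsbigl; apply/seteqP; split=> i /=.
  by move=> [Pi ui0]; split => //; apply: us; apply/eqP.
by move=> [si ui0]; split => //; apply: contrapT => /u0; exact: ui0.
Qed.

Lemma decomposes_seq u (s : seq I) : uniq s ->
  (forall i, i \in s -> P i /\ V i (u i)) -> (forall i, i \notin s -> u i = 0) ->
  decomposes P V (\sum_(i <- s) u i) u.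
Proof.
move=> su sP s0.
have fin : finite_set [set i | u i != 0].
  apply: (@sub_finite_set _ _ [set` s]); last exact: finite_seq.
  by move=> i /= ui; apply: contraT => /s0 u0; rewrite u0 eqxx in ui.
split=> // [i Pi|i nPi|].
- have [/sP[]//|/s0 ->] := boolP (i \in s); exact: (VS Pi).1.
- by apply: s0; apply/negP => /sP[].
rewrite fsbig_seq //; apply: fsbig_widen; first by move=> i /= /sP[].
by move=> i /= [_ /negP]; exact: s0.
Qed.

Lemma decomposes_ex_seq x u : decomposes P V x u ->
  exists s : seq I, [/\ uniq s, forall i, i \in s -> P i /\ V i (u i),
    forall i, i \notin s -> u i = 0 & x = \sum_(i <- s) u i].
Proof.
move=> xu; have [uV u0 ufin _] := xu; exists (finmap.enum_fset (fset_set [set i | u i != 0])).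
have inE i : (i \in finmap.enum_fset (fset_set [set i | u i != 0])) = (u i != 0).
  have := in_fset_set ufin i; rewrite mem_setE; exact.
split.
- exact: finmap.fset_uniq.
- move=> i; rewrite inE => ui; have [Pi|/u0 ui0] := pselect (P i).
    by split=> //; exact: uV.
  by rewrite ui0 eqxx in ui.
- by move=> i; rewrite inE negbK => /eqP.
- by apply: decomposes_support xu _ _ => // i; rewrite inE.
Qed.

Lemma sum_spaceP x : sum_space P V x <->
  exists (s : seq I) (u : I -> E), [/\ uniq s,
    forall i, i \in s -> P i /\ V i (u i) & x = \sum_(i <- s) u i].
Proof.
split=> [[u /decomposes_ex_seq[s [su sP _ ->]]]|[s [u [su sP ->]]]].
  by exists s, u.
(* [decomposes] asks for finite support and zero values outside [P], whereas [u] is arbitrary off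
   [s]. *)
exists (fun i => if i \in s then u i else 0).
have -> : \sum_(i <- s) u i = \sum_(i <- s) (if i \in s then u i else 0).
  by rewrite [LHS]big_seq [RHS]big_seq; apply: eq_bigr => i ->.
apply: decomposes_seq => //; first by move=> i si; rewrite si; exact: sP.
by move=> i /negbTE ->.
Qed.

Lemma decomposes_linear c x y u v : decomposes P V x u -> decomposes P V y v ->
  decomposes P V (c *: x + y) (fun i => c *: u i + v i).
Proof.
move=> xu yv.
have [s1 [_ sP1 s10 _]] := decomposes_ex_seq xu.
have [s2 [_ sP2 s20 _]] := decomposes_ex_seq yv.
have us i : u i != 0 -> i \in undup (s1 ++ s2).
  apply: contraR; rewrite mem_undup mem_cat negb_or => /andP[/s10 -> _].
  by [].
have vs i : v i != 0 -> i \in undup (s1 ++ s2).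
  apply: contraR; rewrite mem_undup mem_cat negb_or => /andP[_ /s20 ->].
  by [].
rewrite (decomposes_support xu (undup_uniq _) us).
rewrite (decomposes_support yv (undup_uniq _) vs).
rewrite scaler_sumr -big_split /=; apply: decomposes_seq; first exact: undup_uniq.
  move=> i; rewrite mem_undup mem_cat => si.
  have Pi : P i by case/orP: si => [/sP1[]|/sP2[]].
  split=> //; apply: (VS Pi).2; first by case: xu => + _ _ _; exact.
  by case: yv => + _ _ _; exact.
move=> i; rewrite mem_undup mem_cat negb_or => /andP[/s10 -> /s20 ->].
by rewrite scaler0 addr0.
Qed.

Lemma decomposes1 i x : P i -> V i x ->
  decomposes P V x (fun j => if j == i then x else 0).
Proof.
move=> Pi Vx; have := @decomposes_seq (fun j => if j == i then x else 0) [:: i].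
rewrite big_seq1 eqxx; apply=> // j; rewrite inE; first by move=> /eqP ->; rewrite eqxx.
by move=> /negbTE ->.
Qed.

Lemma sum_space_subspace : subspace (sum_space P V).
Proof.
split; first by apply/sum_spaceP; exists [::], (fun=> 0); rewrite big_nil.
move=> c x y [u xu] [v yv]; exists (fun i => c *: u i + v i).
exact: decomposes_linear.
Qed.

Lemma sub_sum_space i : P i -> V i `<=` sum_space P V.
Proof. by move=> Pi x Vx; eexists; exact: (decomposes1 Pi Vx). Qed.

Lemma sum_space_sub (Q : set E) : subspace Q -> (forall i, P i -> V i `<=` Q) ->
  sum_space P V `<=` Q.
Proof.
move=> QS VQ x /sum_spaceP [s [u [_ sP ->]]]; rewrite big_seq.
by apply: subspace_sum => // i /sP [Pi]; exact: VQ.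
Qed.

Lemma independent_decomposes x u v : independent P V ->
  decomposes P V x u -> decomposes P V x v -> u = v.
Proof.
move=> Vi xu xv.
have := decomposes_linear (-1) xu xv; rewrite scaleN1r addNr => uv.
have [s [su sP s0 sE]] := decomposes_ex_seq uv.
have /= uv0 := Vi s (fun i => -1 *: u i + v i) su sP (esym sE).
apply/funext => i; have : -1 *: u i + v i = 0.
  by have [/uv0|/s0] := boolP (i \in s).
by rewrite scaleN1r => /eqP; rewrite addrC subr_eq0 => /eqP.
Qed.

Lemma independent_direct_sum X : independent P V -> X = sum_space P V ->
  direct_sum P V X.
Proof. by move=> Vi XE; split=> // x u v; exact: independent_decomposes. Qed.

End Decompositions.

Section GradedOperators.
Context {I : choiceType} {E : lmodType K}.
Variables (P : set I) (A : I -> set E).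
Hypothesis AS : forall i, P i -> subspace (A i).
Hypothesis Ai : independent P A.

(** Abstract form of [component], convertible to it; [graded_op] below stands in the same way for
    [Delta]. *)
Definition graded_comp (x : E) : I -> E := xget (fun=> 0) [set u | decomposes P A x u].

Lemma comp_unique x u : decomposes P A x u -> graded_comp x = u.
Proof.
move=> xu; apply: xget_unique => // v xv; exact: (independent_decomposes AS Ai xv xu).
Qed.

Lemma compP x : sum_space P A x -> decomposes P A x (graded_comp x).
Proof. by move=> [u xu]; rewrite (comp_unique xu). Qed.

Lemma comp_in x i : sum_space P A x -> P i -> A i (graded_comp x i).
Proof. by move=> /compP[+ _ _ _]; exact. Qed.

Lemma comp_linear i : linear_on (sum_space P A) (fun x => graded_comp x i).
Proof.
move=> c x y /compP Ax /compP Ay.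
by rewrite (comp_unique (decomposes_linear AS c Ax Ay)).
Qed.

Lemma comp_homogeneous i x : P i -> A i x -> graded_comp x i = x.
Proof. by move=> Pi Ax; rewrite (comp_unique (decomposes1 AS Pi Ax)) eqxx. Qed.

Lemma comp_homogeneous_neq i j x : P i -> A i x -> j != i -> graded_comp x j = 0.
Proof. by move=> Pi Ax /negbTE ji; rewrite (comp_unique (decomposes1 AS Pi Ax)) ji. Qed.

Lemma comp_eq0 x : sum_space P A x -> (forall i, P i -> graded_comp x i = 0) -> x = 0.
Proof.
move=> /compP Ax c0; have [s [_ sP s0 ->]] := decomposes_ex_seq Ax.
by rewrite big_seq big1 // => i /sP[/c0].
Qed.

Lemma comp_inj x y : sum_space P A x -> sum_space P A y ->
  (forall i, P i -> graded_comp x i = graded_comp y i) -> x = y.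
Proof.
move=> Ax Ay xy; apply/eqP; rewrite -subr_eq0; apply/eqP.
have SS := sum_space_subspace AS.
apply: comp_eq0 => [|i Pi]; first exact: subspaceB.
by rewrite (linear_onB SS (comp_linear i)) // xy // subrr.
Qed.

Definition graded_op (d : I -> E -> E) (x : E) : E := \sum_(i \in P) d i (graded_comp x i).

Lemma graded_op_decomposes d x :
  (forall i, P i -> forall x, A i x -> A i (d i x)) -> (forall i, d i 0 = 0) ->
  sum_space P A x -> decomposes P A (graded_op d x) (fun i => d i (graded_comp x i)).
Proof.
move=> dA d0 /compP Ax; have [cA c0 cfin _] := Ax.
split=> // [i Pi|i nPi|]; first exact/dA/cA.
  by rewrite c0 // d0.
apply: sub_finite_set cfin => i /=; apply: contra_neq => ->; exact: d0.
Qed.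

End GradedOperators.

End SumsOfSubspaces.

(** * Polynomials in Z *)

Section Monomials.
Context {R : realType} {h g : nat}.
Local Notation C := (Cplx R).
Local Notation MC := 'M[C]_(h, g).
Local Notation MN := 'M[nat]_(h, g).
Implicit Types (Z W X Y : MC) (J : MN) (k : 'I_h) (a : 'I_g).

Definition mdeg J : nat := (\sum_k \sum_a J k a)%N.

Definition incr k a J : MN := \matrix_(i, j) (J i j + ((i == k) && (j == a)))%N.

Lemma mdeg_incr k a J : mdeg (incr k a J) = (mdeg J).+1.
Proof.
rewrite /mdeg -addn1.
under eq_bigr => i _ do (under eq_bigr => j _ do rewrite mxE; rewrite big_split /=).
rewrite big_split /=; congr addn.
rewrite (bigD1 k) //= (bigD1 a) //= !eqxx big1 ?addn0; last first.
  by move=> j /negbTE ->; rewrite andbF.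
by rewrite big1 // => i /negbTE ->; rewrite big1.
Qed.

Lemma mdeg0 : mdeg (const_mx 0%N) = 0%N.
Proof. by rewrite /mdeg big1 // => k _; rewrite big1 // => a _; rewrite mxE. Qed.

(** Induction on monomials, one variable at a time: a nonzero exponent matrix has a positive entry,
    which can be lowered by one. *)
Lemma monomial_rect (Q : MN -> Prop) : Q (const_mx 0%N) ->
  (forall k a J, Q J -> Q (incr k a J)) -> forall J, Q J.
Proof.
move=> Q0 QS J; have [n nJ] : exists n, mdeg J = n by exists (mdeg J).
elim: n J nJ => [|n IH] J nJ.
  suff -> : J = const_mx 0%N by [].
  apply/matrixP => k a; rewrite mxE; apply/eqP; rewrite -leqn0 -nJ.
  by rewrite /mdeg (bigD1 k) //= (bigD1 a) //= -addnA leq_addr.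
have [k [a ka]] : exists k a, (0 < J k a)%N.
  apply: contrapT => J0; suff : mdeg J = 0%N by rewrite nJ.
  rewrite /mdeg big1 // => k _; rewrite big1 // => a _; apply/eqP.
  by rewrite -leqn0 leqNgt; apply/negP => Jka; apply: J0; exists k, a.
pose J' : MN := \matrix_(i, j) (J i j - ((i == k) && (j == a)))%N.
have JE : J = incr k a J'.
  apply/matrixP => i j; rewrite !mxE subnK //.
  by case: eqP => // ->; case: eqP => // ->.
by rewrite JE; apply: QS; apply: IH; apply: succn_inj; rewrite -(mdeg_incr k a) -JE.
Qed.

Lemma monomial_const J (z : C) : monomial J (const_mx z) = z ^+ mdeg J.
Proof.
rewrite /monomial /mdeg -prodrXr; apply: eq_bigr => k _.
by rewrite -prodrXr; apply: eq_bigr => a _; rewrite mxE.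
Qed.

Lemma monomial0 Z : monomial (const_mx 0%N) Z = 1.
Proof. by rewrite /monomial big1 // => k _; rewrite big1 // => a _; rewrite mxE expr0. Qed.

Lemma monomial_incr k a J Z : monomial (incr k a J) Z = Z k a * monomial J Z.
Proof.
rewrite /monomial.
under eq_bigr => i _ do (under eq_bigr => j _ do rewrite mxE exprD; rewrite big_split /=).
rewrite big_split /= mulrC; congr (_ * _).
rewrite (bigD1 k) //= (bigD1 a) //= !eqxx big1 ?mulr1; last first.
  by move=> j /negbTE ->; rewrite andbF.
rewrite big1 ?mulr1 //.
by move=> i /negbTE ->; rewrite big1.
Qed.

Lemma monomialM J X Y :
  monomial J (\matrix_(i, j) (X i j * Y i j)) = monomial J X * monomial J Y.
Proof.
rewrite /monomial -big_split; apply: eq_bigr => k _ /=.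
by rewrite -big_split; apply: eq_bigr => a _ /=; rewrite mxE exprMn.
Qed.

Lemma monomial_separates J J' : J != J' ->
  exists Y, monomial J Y != monomial J' Y.
Proof.
move=> JJ'; have [k [a ka]] : exists k a, J k a != J' k a.
  apply: contrapT => H; move/eqP: JJ'; apply; apply/matrixP => k a.
  by apply: contrapT => /eqP ka; apply: H; exists k, a.
pose Y : MC := \matrix_(i, j) (if (i == k) && (j == a) then 2 else 1).
exists Y.
have E (J1 : MN) : monomial J1 Y = 2 ^+ J1 k a.
  rewrite /monomial (bigD1 k) //= (bigD1 a) //= mxE !eqxx /=.
  rewrite big1 ?mulr1; last first.
    by move=> j /negbTE ja; rewrite mxE ja andbF expr1n.
  rewrite big1 ?mulr1 // => i /negbTE ik; rewrite big1 // => j _.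
  by rewrite mxE ik expr1n.
rewrite !E -!natrX eqr_nat; apply: contra_neq ka => /eqP.
by rewrite eqn_exp2l // => /eqP.
Qed.

(* Dedekind's argument: the monomials are distinct characters of the monoid of
   matrices under entrywise multiplication. *)
Lemma monomials_free (s : seq MN) (c : MN -> C) : uniq s ->
  (forall Z, \sum_(J <- s) c J * monomial J Z = 0) -> forall J, J \in s -> c J = 0.
Proof.
elim: s c => [//|J0 s IH] c /= /andP[J0s us] cZ.
have cs J : J \in s -> c J = 0.
  move=> Js; have JJ0 : J != J0 by apply: contraNneq J0s => <-.
  have [Y YJ] := monomial_separates JJ0.
  have := IH (fun J => c J * (monomial J Y - monomial J0 Y)) us _ J Js.
  (* The relation at the entrywise product of [Y] and [Z], minus [monomial J0 Y] times the relation
     at [Z]: the term of [J0] drops out. *)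
  have H : forall Z, \sum_(J <- s) c J * (monomial J Y - monomial J0 Y) * monomial J Z = 0.
    move=> Z; have h1 := cZ (\matrix_(i, j) (Y i j * Z i j)).
    have h2 := cZ Z; rewrite big_cons in h2.
    rewrite big_cons monomialM in h1.
    have {}h1 : c J0 * (monomial J0 Y * monomial J0 Z) +
        \sum_(J <- s) c J * (monomial J Y * monomial J Z) = 0.
      by rewrite -[RHS]h1; congr (_ + _); apply: eq_bigr => J1 _; rewrite monomialM.
    rewrite -[RHS](subrr 0) -[X in _ = X - _]h1.
    rewrite -[X in _ = _ - X](mulr0 (monomial J0 Y)) -[X in _ = _ - _ * X]h2.
    rewrite mulrDr mulr_sumr opprD addrACA mulrCA subrr add0r -sumrB.
    by apply: eq_bigr => J1 _; ring.
  move=> /(_ H) /eqP; rewrite mulf_eq0 subr_eq0 (negbTE YJ) orbF.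
  by move/eqP.
move=> J; rewrite inE => /orP[/eqP ->|/cs//].
have := cZ (const_mx 1); rewrite big_cons monomial_const expr1n mulr1.
by rewrite big_seq big1 ?addr0 // => J1 /cs ->; rewrite mul0r.
Qed.

Lemma big_by_key (T : Type) (F : T -> C) (key : T -> MN) (s : seq T) (r : seq MN) :
  uniq r -> (forall J, J \in map key s -> J \in r) ->
  \sum_(J <- r) \sum_(p <- s | key p == J) F p = \sum_(p <- s) F p.
Proof.
move=> ur; elim: s => [|p s IH] sr.
  by rewrite big_nil big1 // => J _; rewrite big_nil.
rewrite big_cons -IH; last by move=> J Js; apply: sr; rewrite inE Js orbT.
have pr : key p \in r by apply: sr; rewrite inE eqxx.
rewrite (bigD1_seq (key p)) //= big_cons eqxx -addrA; congr (_ + _).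
rewrite [RHS](bigD1_seq (key p)) //=; congr (_ + _).
by apply: eq_bigr => J /negbTE; rewrite eq_sym big_cons => ->.
Qed.

Lemma monomial_coef (s : seq (MN * C)) :
  (forall Z, \sum_(p <- s) p.2 * monomial p.1 Z = 0) ->
  forall J, \sum_(p <- s | p.1 == J) p.2 = 0.
Proof.
move=> sZ J; pose r := undup (map fst s).
have [Jr|Jr] := boolP (J \in r); last first.
  rewrite big_seq_cond big1 // => p /andP[ps /eqP pJ]; case/negP: Jr.
  by rewrite mem_undup -pJ map_f.
apply: (monomials_free (s := r) (c := fun J => \sum_(p <- s | p.1 == J) p.2)) => //.
  exact: undup_uniq.
move=> Z; rewrite -[RHS](sZ Z) -(@big_by_key _ _ fst s r (undup_uniq _)).
  by apply: eq_bigr => J1 _; rewrite mulr_suml; apply: eq_bigr => p /eqP ->.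
by move=> J1; rewrite mem_undup.
Qed.

End Monomials.

Section PolynomialsInZ.
Context {R : realType} {h g : nat}.
Local Notation C := (Cplx R).
Local Notation MC := 'M[C]_(h, g).
Local Notation MN := 'M[nat]_(h, g).
Implicit Types (Z W X Y : MC) (J : MN) (k : 'I_h) (a : 'I_g) (S : set (MC -> C)).
Implicit Types (phi : MC -> MC -> C).

(** The bound on the degree is strict so that [n = 0] leaves only the zero function, the base of the
    later inductions. Lists may repeat exponents, so that sums are concatenations. The class [S] is
    [entire] or, for comparing coefficients, [setT]. *)
Definition poly_lt S (n : nat) : set (MC -> MC -> C) :=
  [set phi | exists s : seq (MN * (MC -> C)),
     (forall p, p \in s -> S p.2 /\ (mdeg p.1 < n)%N) /\
     forall Z W, phi Z W = \sum_(p <- s) p.2 W * monomial p.1 Z].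

Lemma poly_lt0 S phi : poly_lt S 0 phi -> phi = 0.
Proof.
move=> [s [sS E]]; apply/funext => Z; apply/funext => W; rewrite E big_seq.
by rewrite big1 // => p /sS[].
Qed.

Lemma poly_ltW S (T : set (MC -> C)) n m : (n <= m)%N -> S `<=` T ->
  poly_lt S n `<=` poly_lt T m.
Proof.
move=> nm ST phi [s [sS E]]; exists s; split=> // p /sS[Sp pn].
by split; [exact: ST|exact: leq_trans nm].
Qed.

Lemma poly_lt_monomial S n J c : S c -> (mdeg J < n)%N ->
  poly_lt S n (fun Z W => c W * monomial J Z).
Proof.
move=> Sc Jn; exists [:: (J, c)]; split; first by move=> p; rewrite inE => /eqP ->.
by move=> Z W; rewrite big_seq1.
Qed.

Lemma poly_lt_subspace S n : subspace S -> subspace (poly_lt S n).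
Proof.
move=> SS; split; first by exists [::]; split=> // Z W; rewrite big_nil.
move=> c f1 f2 [s1 [sS1 E1]] [s2 [sS2 E2]].
exists (map (fun p => (p.1, c *: p.2)) s1 ++ s2); split.
  move=> p; rewrite mem_cat => /orP[/mapP[q /sS1[Sq qn] ->]|/sS2//] /=.
  by split=> //; exact: subspaceZ.
move=> Z W; rewrite big_cat big_map /= -E2 -[LHS]/(c * f1 Z W + f2 Z W) E1.
by rewrite mulr_sumr; congr (_ + _); apply: eq_bigr => p _; rewrite mulrA.
Qed.

Lemma poly_lt_ind S n (Q : set (MC -> MC -> C)) : subspace Q ->
  (forall J c, (mdeg J < n)%N -> S c -> Q (fun Z W => c W * monomial J Z)) ->
  poly_lt S n `<=` Q.
Proof.
move=> QS Qm phi [s [sS E]].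
have -> : phi = \sum_(p <- s) (fun Z W => p.2 W * monomial p.1 Z).
  apply/funext => Z; apply/funext => W; rewrite E.
  by rewrite !fct_sumE.
rewrite big_seq; apply: subspace_sum => // p /sS[Sp pn]; exact: Qm.
Qed.

Lemma poly_lt_mulX S n k a phi : subspace S -> poly_lt S n phi ->
  poly_lt S n.+1 (fun Z W => Z k a * phi Z W).
Proof.
move=> SS; have [P0 PD] := poly_lt_subspace n.+1 SS; move: phi.
apply: poly_lt_ind.
  split.
    suff -> : (fun Z W => Z k a * (0 : MC -> MC -> C) Z W) = 0 by [].
    by apply/funext => Z; apply/funext => W; rewrite mulr0.
  move=> c f1 f2 /= F1 F2; have := PD c _ _ F1 F2.
  congr (poly_lt S n.+1 _); apply/funext => Z; apply/funext => W.
  rewrite !fctE -[_ *: (_ * _)]/(_ * (_ * _)) -[_ *: f1 Z W]/(_ * _); ring.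
move=> J c Jn Sc /=.
have -> : (fun Z W => Z k a * (c W * monomial J Z)) =
    (fun Z W => c W * monomial (incr k a J) Z).
  by apply/funext => Z; apply/funext => W; rewrite monomial_incr mulrCA.
by apply: poly_lt_monomial => //; rewrite mdeg_incr.
Qed.

End PolynomialsInZ.

Section PolynomialsInZ.
Context {R : realType} {h g : nat}.
Local Notation C := (Cplx R).
Local Notation MC := 'M[C]_(h, g).
Local Notation MN := 'M[nat]_(h, g).
Implicit Types (Z W X Y : MC) (J : MN) (k : 'I_h) (a : 'I_g) (S : set (MC -> C)).
Implicit Types (phi : MC -> MC -> C).

Lemma poly_lt_substitution S n (N : 'M[C]_h) phi : subspace S -> poly_lt S n phi ->
  poly_lt S n (fun Z W => phi (N *m Z) W).
Proof.
move=> SS; have [P0 PD] := poly_lt_subspace n SS; move: phi.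
apply: poly_lt_ind; first by split=> // c f1 f2 F1 F2; exact: PD.
(* The bound is lowered to [(mdeg J).+1], the one that an induction on [J] can carry along. *)
move=> J c Jn Sc; apply: (poly_ltW Jn (@subset_refl _ S)) => {P0 PD}.
move: J {Jn}; apply: monomial_rect => [|k a J IH].
  have -> : (fun Z W => c W * monomial (const_mx 0%N) (N *m Z)) =
      (fun Z W => c W * monomial (const_mx 0%N) Z).
    by apply/funext => Z; apply/funext => W; rewrite !monomial0.
  by apply: poly_lt_monomial.
have -> : (fun Z W => c W * monomial (incr k a J) (N *m Z)) =
   \sum_l N k l *: (fun Z W => Z l a * (c W * monomial J (N *m Z))).
  apply/funext => Z; apply/funext => W; rewrite !fct_sumE monomial_incr mxE.
  rewrite mulr_suml mulr_sumr; apply: eq_bigr => l _.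
  rewrite !fctE -[_ *: _]/(_ * (_ * _)); ring.
rewrite mdeg_incr; have PS := poly_lt_subspace (mdeg J).+2 SS.
apply: subspace_sum => // l _; apply: subspaceZ => //.
exact: poly_lt_mulX.
Qed.

(** Translating [Z] leaves the part of top degree unchanged; this makes the shift by [xi] invisible
    to the top coefficients in [top_coef_theta]. *)
Lemma poly_lt_shift S n (X : MC) phi : subspace S -> poly_lt S n.+1 phi ->
  poly_lt S n (fun Z W => phi (Z + X) W - phi Z W).
Proof.
move=> SS; have PS := poly_lt_subspace n SS; move: phi.
apply: poly_lt_ind.
  split.
    have -> : (fun Z W => (0 : MC -> MC -> C) (Z + X) W - (0 : MC -> MC -> C) Z W) = 0.
      by apply/funext => Z; apply/funext => W; rewrite subrr.
    exact: PS.1.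
  move=> c f1 f2 F1 F2; have := PS.2 c _ _ F1 F2.
  congr (poly_lt S n _); apply/funext => Z; apply/funext => W.
  rewrite !fctE -[c *: (_ - _)]/(c * (_ - _)) -[c *: f1 Z W]/(c * _).
  rewrite -[c *: f1 (Z + X) W]/(c * _); ring.
move=> J c Jn Sc; apply: (poly_ltW (_ : (mdeg J <= n)%N) (@subset_refl _ S)) => //.
move: J {Jn PS n}; apply: monomial_rect => [|k a J IH].
  have PS := poly_lt_subspace (mdeg (const_mx 0%N : MN)) SS.
  have -> : (fun Z W => c W * monomial (const_mx 0%N) (Z + X) -
      c W * monomial (const_mx 0%N) Z) = 0.
    by apply/funext => Z; apply/funext => W; rewrite !monomial0 subrr.
  exact: PS.1.
rewrite mdeg_incr; have PS := poly_lt_subspace (mdeg J).+1 SS.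
(* Discrete product rule for the factors [Z k a] and [monomial J Z]. *)
have -> : (fun Z W => c W * monomial (incr k a J) (Z + X) - c W * monomial (incr k a J) Z)
  = (fun Z W => Z k a * (c W * monomial J (Z + X) - c W * monomial J Z))
    + X k a *: ((fun Z W => c W * monomial J (Z + X) - c W * monomial J Z)
                 + (fun Z W => c W * monomial J Z)).
  apply/funext => Z; apply/funext => W; rewrite !monomial_incr mxE.
  rewrite !fctE /=.
  rewrite -[X k a *: (_ + _)]/(X k a * (_ + _)); ring.
apply: subspaceD => //; first exact: poly_lt_mulX.
apply: subspaceZ => //; apply: subspaceD => //; last exact: poly_lt_monomial.
exact: poly_ltW (leqnSn _) (@subset_refl _ S) _ IH.
Qed.

Lemma poly_lt_coef S n phi : subspace S -> poly_lt S n phi ->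
  exists (s : seq MN) (c : MN -> MC -> C), [/\ uniq s,
    forall J, J \in s -> (mdeg J < n)%N, forall J, S (c J) &
    forall Z W, phi Z W = \sum_(J <- s) c J W * monomial J Z].
Proof.
move=> SS [s [sS E]].
exists (undup (map fst s)), (fun J => \sum_(p <- s | p.1 == J) p.2); split.
- exact: undup_uniq.
- by move=> J; rewrite mem_undup => /mapP[p /sS[_ pn] ->].
- move=> J; rewrite big_seq_cond; apply: subspace_sum => // p /andP[ps _].
  by have [] := sS _ ps.
move=> Z W; rewrite E -(@big_by_key _ _ _ _ _ fst s _ (undup_uniq (map fst s))).
  apply: eq_bigr => J _; rewrite fct_sumE mulr_suml.
  by apply: eq_bigr => p /eqP ->.
by move=> J1; rewrite mem_undup.
Qed.

(** At each fixed [W] this is a linear relation between monomials, in which the exponents of degree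
    [n] do not meet those of the lower terms. Hence the class [setT]. *)
Lemma top_coef_eq0 n (s : seq MN) (c : MN -> MC -> C) : uniq s ->
  (forall J, J \in s -> mdeg J = n) ->
  poly_lt setT n (fun Z W => \sum_(J <- s) c J W * monomial J Z) ->
  forall J, J \in s -> c J = 0.
Proof.
move=> us sn [t [tn E]] J Js; apply/funext => W.
have := @monomial_coef R h g (map (fun J => (J, c J W)) s ++
   map (fun p => (p.1, - p.2 W)) t).
move=> H; have {}H := H _ J; rewrite big_cat !big_map /= in H.
rewrite [X in _ + X]big_seq_cond [X in _ + X]big1 ?addr0 in H; last first.
  move=> p /andP[/tn[_ +] /eqP pJ]; rewrite pJ (sn _ Js) ltnn.
  by [].
rewrite -[RHS]H; last first.
  move=> Z; rewrite big_cat !big_map /= (E Z W).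
  by rewrite -big_split /= big1 // => p _; rewrite mulNr subrr.
rewrite -big_filter filter_pred1_uniq // big_seq1 //.
Qed.

Lemma entire_subspace : subspace (@entire R h g).
Proof.
split; first by move=> W; exact: differentiable_cst.
move=> c f1 f2 F1 F2 W.
exact: (differentiableD (differentiableZ c (F1 W)) (F2 W)).
Qed.

Lemma polynomial_entireP phi :
  polynomial_entire phi <-> exists n, poly_lt (@entire R h g) n phi.
Proof.
split=> [[s [c [ec E]]]|[n /(poly_lt_coef entire_subspace)[s [c [_ _ ec E]]]]].
  exists (\max_(J <- s) mdeg J).+1, (map (fun J => (J, c J)) s); split.
    move=> p /mapP[J Js ->] /=; split; first exact: ec.
    by rewrite ltnS; apply: leq_bigmax_seq.
  by move=> Z W; rewrite big_map E.
by exists s, c.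
Qed.

Lemma poly_lt_differentiable n phi : poly_lt (@entire R h g) n phi ->
  forall Z W, differentiable (phi Z) W.
Proof.
move: phi; apply: poly_lt_ind.
  split=> [Z W|c f1 f2 F1 F2 Z W]; first exact: differentiable_cst.
  exact: (differentiableD (differentiableZ c (F1 Z W)) (F2 Z W)).
move=> J c _ ec Z W.
have -> : (fun W => c W * monomial J Z) = monomial J Z *: c.
  by apply/funext => W'; rewrite mulrC.
exact: differentiableZ.
Qed.

Lemma poly_lt_derive n (v : MC) phi : poly_lt (@entire R h g) n phi ->
  poly_lt (@entire R h g) n (fun Z W => 'D_v (phi Z) W).
Proof.
have PS := poly_lt_subspace n entire_subspace.
(* Derivatives add only for differentiable functions, so the induction has to carry membership in
   [poly_lt] as well. *)
move=> phin; have : (poly_lt (@entire R h g) n `&`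
   [set phi | poly_lt (@entire R h g) n (fun Z W => 'D_v (phi Z) W)]) phi; last by case.
move: phi phin; apply: poly_lt_ind.
  split.
    split; first exact: PS.1.
    apply: (eq_ind_r (poly_lt (@entire R h g) n) PS.1).
    by apply/funext => Z; apply/funext => W; exact: derive_cst.
  move=> c f1 f2 [F1 D1] [F2 D2]; split; first exact: PS.2.
  apply: (eq_ind_r (poly_lt (@entire R h g) n) (PS.2 c _ _ D1 D2)).
  apply/funext => Z; apply/funext => W.
  have d1 : derivable (f1 Z) W v by apply: diff_derivable; exact: poly_lt_differentiable F1 _ _.
  have d2 : derivable (f2 Z) W v by apply: diff_derivable; exact: poly_lt_differentiable F2 _ _.
  have dz : derivable (c *: f1 Z) W v by exact: derivableZ.
  have := deriveD dz d2; rewrite (deriveZ _ d1); exact.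
move=> J c Jn ec; split; first exact: poly_lt_monomial.
have Dc : poly_lt (@entire R h g) n (fun Z W => 'D_v c W * monomial J Z).
  by apply: poly_lt_monomial => // W; exact: differentiable_derive.
apply: (eq_ind_r (poly_lt (@entire R h g) n) Dc).
apply/funext => Z; apply/funext => W.
have cE : (fun W => c W * monomial J Z) = monomial J Z \*: c.
  by apply/funext => W'; rewrite mulrC.
have := deriveZ (monomial J Z) (diff_derivable (v := v) (ec W)).
by rewrite -cE => ->; rewrite [LHS]mulrC.
Qed.

End PolynomialsInZ.

(** * Theta functions and the operators Delta *)

Lemma trace_theta_shift (K : comNzRingType) h g (M : 'M[K]_h) (X W v : 'M[K]_(h, g))
    (B : 'M[K]_h) (t : K) :
  \tr (M *m (B + 2 *: ((W + t *: v) *m X^T))) =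
  \tr (M *m (B + 2 *: (W *m X^T))) + 2 * t * \tr (M *m (v *m X^T)).
Proof.
rewrite mulmxDl scalerDr addrA mulmxDr mxtraceD; congr (_ + _).
by rewrite -scalemxAl !scalerA -scalemxAr mxtraceZ.
Qed.

Section ThetaSpaces.
Context {R : realType} {h g : nat}.
Local Notation C := (Cplx R).
Local Notation MC := 'M[C]_(h, g).
Local Notation MZ := 'M[int]_(h, g).
Local Notation MN := 'M[nat]_(h, g).
Implicit Types (Z W : MC) (J : MN) (k : 'I_h) (a : 'I_g).
Implicit Types (phi : MC -> MC -> C) (f : MC -> C).
Variables (Om : 'M[C]_g) (M : 'M[int]_h).

Lemma theta_subspace : subspace (theta_space Om M : set (MC -> C)).
Proof.
split; first by split=> [|W xi eta]; [exact: entire_subspace.1|rewrite mulr0].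
move=> c f1 f2 [e1 t1] [e2 t2]; split; first exact: entire_subspace.2.
move=> W xi eta; have := t1 W xi eta; have := t2 W xi eta.
rewrite !fctE => -> ->; rewrite mulrDr; congr (_ + _).
exact: mulrCA.
Qed.

Lemma aux_subspace : subspace (aux_space Om M : set (MC -> MC -> C)).
Proof.
split.
  split; last by move=> *; rewrite mulr0.
  apply/polynomial_entireP; exists 0%N; exact: (poly_lt_subspace 0 entire_subspace).1.
move=> c f1 f2 [e1 t1] [e2 t2]; split.
  move/polynomial_entireP: e1 => [n1 e1]; move/polynomial_entireP: e2 => [n2 e2].
  apply/polynomial_entireP; exists (n1 + n2)%N.
  apply: (poly_lt_subspace _ entire_subspace).2.
    by apply: poly_ltW e1; rewrite ?leq_addr.
  by apply: poly_ltW e2; rewrite ?leq_addl.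
move=> Z W xi eta; have := t1 Z W xi eta; have := t2 Z W xi eta.
rewrite !fctE => -> ->; rewrite mulrDr; congr (_ + _).
exact: mulrCA.
Qed.

Lemma poly_lt_Zfree f : entire f -> poly_lt (@entire R h g) 1 (Zfree f).
Proof.
move=> ef; have := @poly_lt_monomial R h g (@entire R h g) 1 (const_mx 0%N) f ef.
rewrite mdeg0 => /(_ isT) fn; apply: (eq_ind_r (poly_lt _ 1) fn).
apply/funext => Z; apply/funext => W.
by rewrite monomial0 mulr1.
Qed.

Lemma Zfree_theta f : theta_space Om M f -> aux_space Om M (Zfree f).
Proof.
move=> [ef tf]; split; last by move=> Z W xi eta; exact: tf.
by apply/polynomial_entireP; exists 1%N; exact: poly_lt_Zfree.
Qed.

Lemma Zfree_linear : linear_on setT (Zfree : (MC -> C) -> (MC -> MC -> C)).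
Proof. by []. Qed.

Lemma partial_op_linear k a : linear_on polynomial_entire (@partial_op R h g M k a).
Proof.
move=> c f1 f2 /polynomial_entireP[n1 e1] /polynomial_entireP[n2 e2].
apply/funext => Z; apply/funext => W.
have d1 : derivable (f1 Z) W (delta_mx k a).
  by apply: diff_derivable; exact: poly_lt_differentiable e1 _ _.
have d2 : derivable (f2 Z) W (delta_mx k a).
  by apply: diff_derivable; exact: poly_lt_differentiable e2 _ _.
have dz : derivable (c *: f1 Z) W (delta_mx k a) by exact: derivableZ.
have D : 'D_(delta_mx k a) ((c *: f1 + f2) Z) W =
    c * 'D_(delta_mx k a) (f1 Z) W + 'D_(delta_mx k a) (f2 Z) W.
  by have := deriveD dz d2; rewrite (deriveZ _ d1); exact.
have E : (c *: f1 + f2) Z W = c * f1 Z W + f2 Z W by [].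
have -> : (c *: partial_op M k a f1 + partial_op M k a f2) Z W =
  c * partial_op M k a f1 Z W + partial_op M k a f2 Z W by [].
rewrite /partial_op D E; move: ('D_ _ (f1 Z) W) ('D_ _ (f2 Z) W) (f1 Z W) (f2 Z W).
by move: (\sum_l _) => *; ring.
Qed.

Lemma partial_op_poly n k a phi : poly_lt (@entire R h g) n phi ->
  poly_lt (@entire R h g) n.+1 (partial_op M k a phi).
Proof.
move=> pn; have PS := poly_lt_subspace n.+1 (@entire_subspace R h g).
pose psi := \sum_l (2 * pi_i R * (M k l)%:~R) *: (fun Z W => Z l a * phi Z W).
have psin : poly_lt (@entire R h g) n.+1 psi.
  apply: (subspace_sum _ PS) => l _.
  exact: (subspaceZ _ PS (poly_lt_mulX l a entire_subspace pn)).
have Dn := poly_ltW (leqnSn n) (@subset_refl _ _) (poly_lt_derive (delta_mx k a) pn).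
apply: (eq_ind_r (poly_lt (@entire R h g) n.+1) (subspaceD PS psin Dn)).
apply/funext => Z; apply/funext => W; rewrite /partial_op.
have -> : (psi + (fun Z W => 'D_(delta_mx k a) (phi Z) W)) Z W =
  psi Z W + 'D_(delta_mx k a) (phi Z) W by [].
congr (_ + _); rewrite /psi !fct_sumE mulr_sumr mulr_suml.
apply: eq_bigr => l _.
have -> : ((2 * pi_i R * (M k l)%:~R) *: (fun Z W => Z l a * phi Z W)) Z W =
  (2 * pi_i R * (M k l)%:~R) * (Z l a * phi Z W) by [].
by rewrite !mulrA.
Qed.

Hypothesis Msym : M^T = M.

(** The logarithmic derivative is the negative of the increment of the multiplier [2 pi i (M Z) k a]
    under [Z + xi]. This cancellation makes [partial_op] preserve [aux_space Om M]. *)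
Lemma is_derive_theta_factor (xi : MZ) W k a :
  is_derive W (delta_mx k a) (theta_factor M Om xi)
   (theta_factor M Om xi W *
     (- (2 * pi_i R * (\sum_l (M k l)%:~R * (xi l a)%:~R)))).
Proof.
set l0 := - (2 * _ * _); set v := delta_mx k a.
pose X : MC := map_mx intr xi.
pose A W : C := - pi_i R * \tr (map_mx intr M *m (X *m Om *m X^T + 2 *: (W *m X^T))).
have AE (t : C) : A (W + t *: v) = A W + l0 * t.
  have E0 := trace_theta_shift (map_mx intr M) X W v (X *m Om *m X^T) t.
  apply: (etrans (congr1 (fun z => - pi_i R * z) E0)).
  pose TW := \tr (map_mx intr M *m (X *m Om *m X^T + 2 *: (W *m X^T))) : C.
  have -> : A W = - pi_i R * TW by [].
  rewrite -/TW /l0 {E0}.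
  suff -> : \tr (map_mx intr M *m (v *m X^T)) = \sum_l (M k l)%:~R * (xi l a)%:~R.
    by move: TW (\sum_l _) (pi_i R) => *; ring.
  rewrite mulmxA mxtrace_mulC mulmxA.
  rewrite /mxtrace.
  (* After a cyclic permutation, only the diagonal entry at [a] survives. The product contains
     column [k] of [M]; symmetry turns it into row [k]. *)
  have E i : (X^T *m map_mx intr M *m v) i i = (i == a)%:R * \sum_l (M k l)%:~R * (xi l a)%:~R.
    rewrite mxE (bigD1 k) //= big1 ?addr0; last first.
      by move=> j /negbTE jk; rewrite !mxE jk mulr0.
    rewrite [v k i]mxE eqxx /= mulrC; have [->|_] := eqVneq i a; last by rewrite !mul0r.
    rewrite mxE; congr (_ * _); apply: eq_bigr => l _; rewrite !mxE mulrC.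
    by rewrite -{1}Msym mxE.
  rewrite (bigD1 a) //= E eqxx mul1r [X in _ + X]big1 ?addr0 // => i /negbTE ia.
  by rewrite E ia mul0r.
have d1 : is_derive (0 : C) 1 (fun t : C => theta_factor M Om xi (W + t *: v))
    (theta_factor M Om xi W * l0).
  have -> : (fun t : C => theta_factor M Om xi (W + t *: v)) =
      @cexp R \o (fun t : C => A W + l0 * t).
    by apply/funext => t; rewrite /= -AE.
  have dA : is_diff (0 : C) (fun t : C => A W + l0 * t) (fun t => l0 * t).
    have dl : is_diff (0 : C) (fun t : C => l0 * t) (fun t => l0 * t).
      exact: is_diff_scaler.
    have := is_diffD (is_diff_cst (A W) (0 : C)) dl.
    by move=> H; apply: (is_diff_eq H); apply/funext => t; exact: add0r.
  have dE := is_diff_cexp (A W + l0 * 0).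
  have dc := is_diff_comp dA dE.
  have df : differentiable (@cexp R \o (fun t : C => A W + l0 * t)) (0 : C).
    exact: ex_diff.
  apply: DeriveDef; first exact: diff_derivable.
  by rewrite deriveE // diff_val /= mulr0 addr0 mulr1.
have E1 : (fun t : C => theta_factor M Om xi (t *: v + W)) =
    (fun t : C => theta_factor M Om xi (W + t *: v)).
  by apply/funext => t; rewrite addrC.
have dl : derivable (theta_factor M Om xi) W v.
  apply: (iffRL (derivable1P (theta_factor M Om xi) W v)).
  rewrite E1; exact: (@ex_derive _ _ _ _ _ _ _ d1).
have V := derive_line (theta_factor M Om xi) W v 0.
rewrite (@derive_val _ _ _ _ _ _ _ d1) scale0r addr0 in V.
exact: (DeriveDef dl (esym V)).
Qed.

Lemma partial_op_aux k a phi : aux_space Om M phi ->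
  aux_space Om M (partial_op M k a phi).
Proof.
move=> [/polynomial_entireP[n pn] tphi]; split.
  by apply/polynomial_entireP; exists n.+1; exact: partial_op_poly.
move=> Z W xi eta; set c := mulZ xi Om; set v : MC := delta_mx k a.
have dphi Z' W' : derivable (phi Z') W' v.
  by apply: diff_derivable; exact: poly_lt_differentiable pn _ _.
have := is_derive_theta_factor xi W k a; rewrite -/v => dE.
have dEv := @derive_val _ _ _ _ _ _ _ dE.
have dEd : derivable (theta_factor M Om xi) W v by exact: ex_derive.
(* Quasi-periodicity as an identity of functions of [W], so that both sides can be
   differentiated. *)
have FE : (fun X => phi (Z + map_mx intr xi) (X + (c + map_mx intr eta))) =
    theta_factor M Om xi * phi Z.
  by apply/funext => X; rewrite addrA tphi.
have := derive_translate (phi (Z + map_mx intr xi)) (c + map_mx intr eta) W v.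
have DM := deriveM dEd (dphi Z W).
rewrite FE DM dEv => D.
rewrite /partial_op -/v -addrA -D addrA tphi.
have -> : \sum_l (M k l)%:~R * (Z + map_mx intr xi) l a =
   \sum_l (M k l)%:~R * Z l a + \sum_l (M k l)%:~R * (xi l a)%:~R :> C.
  by rewrite -big_split /=; apply: eq_bigr => l _; rewrite !mxE mulrDr.
move: (\sum_l _ * _) (\sum_l _ * _) (theta_factor M Om xi W) (phi Z W) ('D_v (phi Z) W).
move=> s1 s2 E p D1; rewrite -[E *: _]/(E * _) -[p *: _]/(p * _); ring.
Qed.

End ThetaSpaces.

(** * Independence of theta factors *)

Section QuadraticForms.

(** A sum of two powers of 3 is less than the power following the larger one, so the larger exponent
    can be read off first. *)
Lemma sum_pow3_inj k l k' l' : (k <= l)%N -> (k' <= l')%N ->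
  (3 ^ k + 3 ^ l = 3 ^ k' + 3 ^ l')%N -> k = k' /\ l = l'.
Proof.
have lt a b c d : (a <= b)%N -> (b < d)%N -> (3 ^ a + 3 ^ b < 3 ^ c + 3 ^ d)%N.
  move=> ab bd; have h1 : (3 ^ a <= 3 ^ b)%N by rewrite leq_exp2l.
  have h2 : (3 ^ b.+1 <= 3 ^ d)%N by rewrite leq_exp2l.
  have h3 : (0 < 3 ^ b)%N by rewrite expn_gt0.
  rewrite expnS in h2; apply: (@leq_trans (3 * 3 ^ b)); last first.
    by rewrite (leq_trans h2) // leq_addl.
  rewrite !mulSn mul0n addn0 addnA ltn_add2r (leq_ltn_trans h1) //.
  by rewrite -[X in (X < _)%N]addn0 ltn_add2l.
move=> kl kl' e; have ll : l = l'.
  case: (ltngtP l l') => // [ll|ll].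
    by have := lt _ _ k' _ kl ll; rewrite e ltnn.
  by have := lt _ _ k _ kl' ll; rewrite e ltnn.
split=> //; move: e; rewrite ll => /addIn /eqP.
by rewrite eqn_exp2l // => /eqP.
Qed.

Definition qform (h : nat) (M : 'M[int]_h) (x : 'I_h -> int) : int :=
  \sum_k \sum_l M k l * x k * x l.

Lemma qformB h (M N : 'M[int]_h) x : qform (M - N) x = qform M x - qform N x.
Proof.
rewrite /qform -sumrB; apply: eq_bigr => k _; rewrite -sumrB.
by apply: eq_bigr => l _; rewrite !mxE !mulrBl.
Qed.

(** The integers [0, ..., size p - 1] are more numerous than the roots of [p]. *)
Lemma poly_nonroot (p : {poly int}) : p != 0 -> exists t : int, p.[t] != 0.
Proof.
move=> p0; apply: contrapT => nt.
pose rs := [seq (i : nat)%:Z | i <- iota 0 (size p)].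
have := @max_poly_roots _ p rs p0; rewrite size_map size_iota ltnn => h.
suff : false by []. apply: h.
  apply/allP => t _; apply/rootP; apply: contrapT => /eqP pt; apply: nt; by exists t.
by rewrite map_inj_uniq ?iota_uniq // => i j [].
Qed.

(* Kronecker's substitution: [x k = t ^ (3 ^ k)] makes the products [x k * x l]
   distinct powers of [t]. *)
Definition qpoly (h : nat) (D : 'M[int]_h) : {poly int} :=
  \sum_(k < h) \sum_(l < h) D k l *: 'X^(3 ^ k + 3 ^ l).

Lemma qpoly_horner h (D : 'M[int]_h) t :
  (qpoly D).[t] = qform D (fun k => t ^+ (3 ^ k)).
Proof.
rewrite /qpoly horner_sum; apply: eq_bigr => k _; rewrite horner_sum.
by apply: eq_bigr => l _; rewrite hornerZ hornerXn exprD mulrA.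
Qed.

Lemma qpoly_neq0 h (D : 'M[int]_h) : D^T = D -> D != 0 -> qpoly D != 0.
Proof.
move=> Ds; apply: contra_neq => p0; apply/matrixP => k0 l0; rewrite mxE.
have Dsym k l : D k l = D l k by rewrite -{1}Ds mxE.
pose b (k l : 'I_h) : nat := (3 ^ k0 + 3 ^ l0 == 3 ^ k + 3 ^ l)%N.
have bD k l : D k l * (b k l)%:R = D k0 l0 * (b k l)%:R.
  rewrite /b; case: eqP => [e|]; last by rewrite !mulr0.
  rewrite !mulr1.
  case: (leqP k0 l0) => [h1|/ltnW h1]; case: (leqP k l) => [h2|/ltnW h2].
  - by have [/ord_inj -> /ord_inj ->] := sum_pow3_inj h1 h2 e.
  - rewrite [RHS]addnC in e.
    by have [/ord_inj -> /ord_inj ->] := sum_pow3_inj h1 h2 e; rewrite Dsym.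
  - rewrite [LHS]addnC in e.
    by have [/ord_inj -> /ord_inj ->] := sum_pow3_inj h1 h2 e; rewrite Dsym.
  - rewrite [LHS]addnC [RHS]addnC in e.
    by have [/ord_inj -> /ord_inj ->] := sum_pow3_inj h1 h2 e.
(* Only the index pairs equal to [(k0, l0)] up to order reach this exponent, and by symmetry they
   carry the same entry. The count is positive, since [(k0, l0)] is among them. *)
have : (qpoly D)`_(3 ^ k0 + 3 ^ l0) = D k0 l0 * (\sum_k \sum_l b k l)%N%:R.
  rewrite /qpoly coef_sum natr_sum mulr_sumr; apply: eq_bigr => k _.
  rewrite coef_sum natr_sum mulr_sumr; apply: eq_bigr => l _.
  by rewrite coefZ coefXn -bD.
rewrite p0 coef0 => /esym/eqP; rewrite mulf_eq0 => /orP[/eqP//|].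
rewrite pnatr_eq0 (bigD1 k0) //= (bigD1 l0) //= /b eqxx.
by rewrite -addnA.
Qed.

(** The product of the polynomials [qpoly (M - N)] over all pairs is nonzero; one non-root of it
    separates all the forms at once. *)
Lemma qform_separates h (s : seq 'M[int]_h) : uniq s -> (forall M, M \in s -> M^T = M) ->
  exists x, {in s &, injective (fun M => qform M x)}.
Proof.
move=> us ssym.
pose p := \prod_(M <- s) \prod_(N <- s | N != M) qpoly (M - N).
have p0 : p != 0.
  rewrite /p prodf_seq_neq0; apply/allP => M Ms /=.
  rewrite prodf_seq_neq0; apply/allP => N Ns; apply/implyP => NM.
  apply: qpoly_neq0; last by rewrite subr_eq0 eq_sym.
  by rewrite linearB /= !ssym.
have [t tp] := poly_nonroot p0; exists (fun k => t ^+ (3 ^ k)).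
move=> M N Ms Ns /eqP; rewrite -subr_eq0 -qformB -qpoly_horner => /eqP MN0.
apply: contrapT => /eqP MN; move/negP: tp; apply.
rewrite /p horner_prod prodf_seq_eq0; apply/hasP; exists M => //=.
rewrite horner_prod prodf_seq_eq0; apply/hasP; exists N => //=.
by rewrite eq_sym MN MN0 eqxx.
Qed.

End QuadraticForms.

(** * Linear independence of exponentials of quadratic functions of [n] *)

Section QuadraticExponentials.
Context {R : realType}.
Local Notation C := (Cplx R).

Lemma geometric_small (r e : R) : 0 <= r < 1 -> 0 < e ->
  exists N, forall n, (N <= n)%N -> r ^+ n <= e.
Proof.
move=> /andP[r0 r1] e0.
have : (fun n => r ^+ n) @ \oo --> (0 : R) by apply: cvg_expr; rewrite ger0_norm.
move=> /cvgrPdist_le /(_ _ e0) [N _ NP]; exists N => n Nn.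
by have := NP n Nn; rewrite /= sub0r normrN ger0_norm // exprn_ge0.
Qed.

(** The product [r ^+ (n ^ 2) * t ^+ n] is the [n]-th power of [r ^+ n * t], which is eventually at
    most [1 / 2]. *)
Lemma gaussian_small (b r t e : R) : 0 <= b -> 0 <= r < 1 -> 0 <= t -> 0 < e ->
  exists N, forall n, (N <= n)%N -> b * (r ^+ (n ^ 2) * t ^+ n) <= e.
Proof.
move=> b0 r01 t0 e0; have /andP[r0 r1] := r01.
have t1 : 0 < t + 1 by rewrite ltr_pwDr.
have b1 : 0 < b + 1 by rewrite ltr_pwDr.
have [N1 h1] := geometric_small r01 (divr_gt0 (@divr_gt0 R 1 2 ltr01 (ltr0Sn _ _)) t1).
have half01 : 0 <= (1 / 2 : R) < 1 by apply/andP; split; lra.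
have [N2 h2] := geometric_small half01 (divr_gt0 e0 b1).
exists (N1 + N2)%N => n Nn.
have n1 := h1 n (leq_trans (leq_addr _ _) Nn).
have n2 := h2 n (leq_trans (leq_addl _ _) Nn).
have rt : r ^+ n * t <= 1 / 2.
  rewrite (le_trans (ler_wpM2r t0 n1)) // mulrAC ler_pdivrMr //.
  by rewrite ler_wpM2l //; lra.
have -> : r ^+ (n ^ 2) * t ^+ n = (r ^+ n * t) ^+ n.
  by rewrite exprMn -exprM mulnn.
have rtn : (r ^+ n * t) ^+ n <= e / (b + 1).
  apply: le_trans n2; apply: lerXn2r => //; rewrite nnegrE.
    by rewrite mulr_ge0 // exprn_ge0.
  by rewrite divr_ge0.
rewrite (le_trans (ler_wpM2l b0 rtn)) // mulrA ler_pdivrMr // mulrC.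
by rewrite ler_wpM2l ?(ltW e0) // lerDl.
Qed.

Lemma sum_small (I : eqType) (s : seq I) (F : I -> nat -> R) :
  (forall i, i \in s -> forall e, 0 < e -> exists N, forall n, (N <= n)%N -> F i n <= e) ->
  forall e, 0 < e -> exists N, forall n, (N <= n)%N -> \sum_(i <- s) F i n <= e.
Proof.
elim: s => [|i s IH] sF e e0.
  by exists 0%N => n _; rewrite big_nil ltW.
have e2 : 0 < e / 2 by rewrite divr_gt0.
have [N1 h1] := sF i (mem_head _ _) _ e2.
have [|N2 h2] := IH _ _ e2; first by move=> j js; apply: sF; rewrite inE js orbT.
exists (N1 + N2)%N => n Nn; rewrite big_cons [e]splitr lerD //.
  exact: h1 n (leq_trans (leq_addr _ _) Nn).
exact: h2 n (leq_trans (leq_addl _ _) Nn).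
Qed.

Lemma seq_argmax (I : eqType) (s : seq I) (m : I -> R) : s != [::] ->
  exists2 i0, i0 \in s & forall i, i \in s -> m i <= m i0.
Proof.
elim: s => [//|i s IH] _; have [->|s0] := eqVneq s [::].
  by exists i; rewrite ?mem_head // => j; rewrite inE => /eqP ->.
have [j js jP] := IH s0; case: (leP (m i) (m j)) => ij.
  exists j; first by rewrite inE js orbT.
  by move=> k; rewrite inE => /orP[/eqP ->//|/jP].
exists i; first exact: mem_head.
move=> k; rewrite inE => /orP[/eqP ->//|/jP kj].
exact: le_trans kj (ltW ij).
Qed.

Lemma nrm_sum (I : Type) (s : seq I) (F : I -> C) :
  nrm (\sum_(i <- s) F i) <= \sum_(i <- s) nrm (F i).
Proof.
elim: s => [|i s IH]; first by rewrite !big_nil nrm0.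
by rewrite !big_cons (le_trans (nrmD _ _)) // lerD.
Qed.

(* The term with the largest [nrm (u i)] dominates all the others as [n] grows. *)
Lemma quadratic_exponentials_free (I : eqType) (s : seq I) (a u v : I -> C) :
  uniq s -> (forall i, u i != 0) -> (forall i, v i != 0) ->
  {in s &, injective (fun i => nrm (u i))} ->
  (forall n, \sum_(i <- s) a i * (u i ^+ (n ^ 2) * v i ^+ n) = 0) ->
  forall i, i \in s -> a i = 0.
Proof.
have nrm_gt0 (x : C) : x != 0 -> 0 < nrm x.
  by move=> x0; rewrite lt_neqAle nrm_ge0 andbT eq_sym; apply: contra_neq x0; exact: nrm0_eq0.
move=> us u0 v0; have [n sn] : exists n, size s = n by exists (size s).
elim: n s sn us => [|n IH] s sn us uinj sum0; first by move/size0nil: sn => ->.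
have sN : s != [::] by case: s sn {us uinj sum0}.
have [i0 i0s i0P] := seq_argmax (fun i => nrm (u i)) sN.
have split0 m : a i0 * (u i0 ^+ (m ^ 2) * v i0 ^+ m) +
    \sum_(i <- rem i0 s) a i * (u i ^+ (m ^ 2) * v i ^+ m) = 0.
  by rewrite -[RHS](sum0 m) (perm_big _ (perm_to_rem i0s)) big_cons.
have rems i : i \in rem i0 s -> i \in s /\ i != i0.
  by rewrite mem_rem_uniq // inE => /andP[].
have a0 : a i0 = 0.
  apply: nrm0_eq0; apply/eqP; rewrite eq_le nrm_ge0 andbT.
  apply/ler_addgt0Pr => e e0; rewrite add0r.
  pose F i m := nrm (a i) * (nrm (u i / u i0) ^+ (m ^ 2) * nrm (v i / v i0) ^+ m).
  have [N NP] : exists N, forall m, (N <= m)%N -> \sum_(i <- rem i0 s) F i m <= e.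
    apply: sum_small e0 => i /rems[si ii0] d d0.
    apply: gaussian_small d0; rewrite ?nrm_ge0 //=.
    rewrite nrmM nrmV ltr_pdivrMr ?nrm_gt0 // mul1r lt_neqAle i0P // andbT.
    by apply: contra_neq ii0; exact: uinj.
  apply: le_trans (NP N (leqnn N)).
  have := split0 N; set w := u i0 ^+ _ * _ => wE.
  have w0 : w != 0 by rewrite mulf_neq0 // expf_neq0.
  have -> : a i0 = - (\sum_(i <- rem i0 s) a i * (u i ^+ (N ^ 2) * v i ^+ N)) / w.
    apply: (mulIf w0); rewrite divfK //; apply/eqP.
    by rewrite -addr_eq0; apply/eqP.
  rewrite mulNr nrmN mulr_suml (le_trans (nrm_sum _ _)) //.
  apply: ler_sum => i _; rewrite /F -!nrmX -!nrmM.
  rewrite !expr_div_n /w invfM le_eqVlt; apply/orP; left; apply/eqP; congr nrm.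
  by rewrite -!mulrA; congr (_ * (_ * _)); rewrite mulrCA.
move=> i; have [->//|ii0] := eqVneq i i0 => si.
apply: (IH (rem i0 s)); rewrite ?rem_uniq ?size_rem ?sn //.
- by move=> j k /rems[js _] /rems[ks _]; exact: uinj.
- by move=> m; have := split0 m; rewrite a0 mul0r add0r.
- by rewrite mem_rem_uniq // inE ii0.
Qed.

End QuadraticExponentials.

Lemma trace_theta_scale (K : comNzRingType) h g (M : 'M[K]_h) (X W : 'M[K]_(h, g))
    (Om : 'M[K]_g) (n : K) :
  \tr (M *m ((n *: X) *m Om *m (n *: X)^T + 2 *: (W *m (n *: X)^T))) =
  n ^+ 2 * \tr (M *m (X *m Om *m X^T)) + n * \tr (M *m (2 *: (W *m X^T))).
Proof.
rewrite linearZ /= -!scalemxAl -!scalemxAr scalerA -expr2.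
by rewrite [2 *: (n *: _)]scalerA [2 * n]mulrC -[(n * 2) *: _]scalerA
  mulmxDr mxtraceD -!scalemxAr !mxtraceZ.
Qed.

Section ThetaFactorsFree.
Context {R : realType} {h g : nat}.
Local Notation C := (Cplx R).
Local Notation MC := 'M[C]_(h, g).
Local Notation MZ := 'M[int]_(h, g).

Lemma cexp_natmul (n : nat) (z : C) : cexp (n%:R * z) = cexp z ^+ n.
Proof.
elim: n => [|n IH]; first by rewrite mul0r cexp0.
by rewrite -natr1 mulrDl mul1r cexpD IH exprSr.
Qed.

Lemma cexp_quadratic n (p t1 t2 : C) :
  cexp (p * (n%:R ^+ 2 * t1 + n%:R * t2)) = cexp (p * t1) ^+ (n ^ 2) * cexp (p * t2) ^+ n.
Proof.
by rewrite -!cexp_natmul -cexpD natrX; congr cexp; ring.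
Qed.

Lemma posdef_diag n (S : 'M[R]_n) i : posdef S -> 0 < S i i.
Proof.
move=> /(_ (delta_mx i 0)); rewrite trmx_delta -rowE -colE !mxE; apply.
by apply/eqP => /matrixP /(_ i 0); rewrite !mxE !eqxx /= => /eqP; rewrite oner_eq0.
Qed.

Lemma theta_factors_free (Om : 'M[C]_g) (a0 : 'I_g) (W : MC)
    (s : seq 'M[int]_h) (c : 'M[int]_h -> C) :
  siegel Om -> uniq s -> (forall M, M \in s -> M^T = M) ->
  (forall xi : MZ, \sum_(M <- s) theta_factor M Om xi W * c M = 0) ->
  forall M, M \in s -> c M = 0.
Proof.
move=> [_ Ompos] us ssym sum0.
have [x xinj] := qform_separates us ssym.
(* With one nonzero column, the quadratic part of the exponent is [qform M x] times [Om a0 a0]. The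
   imaginary part of this entry is positive, so distinct values of the form give distinct moduli. *)
pose xi1 : MZ := \matrix_(l, a) (if a == a0 then x l else 0).
pose X : MC := map_mx intr xi1.
pose u (M : 'M[int]_h) := cexp (- pi_i R * \tr (map_mx intr M *m (X *m Om *m X^T))).
pose v (M : 'M[int]_h) := cexp (- pi_i R * \tr (map_mx intr M *m (2 *: (W *m X^T)))).
have uv n M : theta_factor M Om (n%:Z *: xi1) W = u M ^+ (n ^ 2) * v M ^+ n.
  pose G (Y : MC) := cexp (- pi_i R *
    \tr (map_mx intr M *m (Y *m Om *m Y^T + 2 *: (W *m Y^T)))).
  have H1 : theta_factor M Om (n%:Z *: xi1) W = G (map_mx intr (n%:Z *: xi1)) by [].
  have Xn : map_mx intr (n%:Z *: xi1) = (n%:R : C) *: X by exact: map_mxZ.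
  have E := trace_theta_scale (map_mx intr M) X W Om (n%:R : C).
  have H2 := congr1 (fun z => cexp (- pi_i R * z)) E.
  rewrite H1 Xn; apply: (etrans H2); exact: cexp_quadratic.
have trE (M : 'M[int]_h) :
    \tr (map_mx intr M *m (X *m Om *m X^T)) = (qform M x)%:~R * Om a0 a0 :> C.
  have XO l k : (X *m Om *m X^T) l k = (x l)%:~R * (x k)%:~R * Om a0 a0.
    rewrite mxE (bigD1 a0) //= big1 ?addr0; last first.
      by move=> b /negbTE ba; rewrite !mxE ba mulr0.
    rewrite !mxE eqxx (bigD1 a0) //= big1 ?addr0; last first.
      by move=> b /negbTE ba; rewrite !mxE ba mul0r.
    by rewrite !mxE eqxx mulrAC.
  rewrite /mxtrace /qform rmorph_sum mulr_suml; apply: eq_bigr => k _ /=.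
  rewrite mxE rmorph_sum mulr_suml; apply: eq_bigr => l _ /=.
  by rewrite XO mxE !rmorphM /=; ring.
have nu M : nrm (u M) = expR (pi * ((qform M x)%:~R * complex.Im (Om a0 a0))).
  rewrite nrm_cexp trE -[(qform M x)%:~R](rmorph_int (real_complex R)) /pi_i.
  by case: (Om a0 a0) => p q /=; congr expR; ring.
have Om0 : 0 < complex.Im (Om a0 a0).
  by have := posdef_diag a0 Ompos; rewrite mxE.
have u0 M : u M != 0 by exact: cexp_neq0.
have v0 M : v M != 0 by exact: cexp_neq0.
have uinj : {in s &, injective (fun M => nrm (u M))}.
  move=> M N Ms Ns e; have {e} /expR_inj := etrans (esym (nu M)) (etrans e (nu N)).
  have p0 : (pi : R) != 0 by rewrite gt_eqF // pi_gt0.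
  have O0 : complex.Im (Om a0 a0) != 0 by rewrite gt_eqF.
  by move=> /(mulfI p0) /(mulIf O0) /eqP; rewrite eqr_int => /eqP /xinj; apply.
have uv0 n : \sum_(M <- s) c M * (u M ^+ (n ^ 2) * v M ^+ n) = 0.
  rewrite -[RHS](sum0 (n%:Z *: xi1)); apply: eq_bigr => M _.
  by rewrite uv mulrC.
exact: (quadratic_exponentials_free us u0 v0 uinj uv0).
Qed.

Lemma aux_independent (Om : 'M[C]_g) : (0 < g)%N -> siegel Om ->
  independent (@even_posdef R h) (@aux_space R h g Om).
Proof.
move=> g0 Omp s u us sP sum0 M Ms; apply/funext => Z; apply/funext => W.
apply: (@theta_factors_free Om (Ordinal g0) W s (fun N => u N Z W)) => //.
  by move=> N /sP[[]].
move=> xi; have := congr1 (fun f => f (Z + map_mx intr xi) (W + mulZ xi Om)) sum0.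
rewrite /= !fct_sumE => E; rewrite -[RHS]E.
rewrite big_seq [RHS]big_seq; apply: eq_bigr => N /sP[_ [_ /(_ Z W xi 0)]].
by rewrite map_mx0 addr0 => ->.
Qed.

End ThetaFactorsFree.

(** * Leading terms *)

Section LeadingTerms.
Context {R : realType} {h g : nat}.
Local Notation C := (Cplx R).
Local Notation MC := 'M[C]_(h, g).
Local Notation MZ := 'M[int]_(h, g).
Local Notation MN := 'M[nat]_(h, g).
Local Notation entire := (@entire R h g).
Implicit Types (Z W : MC) (J K : MN) (k : 'I_h) (a : 'I_g).
Implicit Types (phi : MC -> MC -> C) (f : MC -> C).
Variables (M : 'M[int]_h).

Definition partialJ_seq J (r : seq ('I_h * 'I_g)) : (MC -> MC -> C) -> (MC -> MC -> C) :=
  \big[(fun F G => F \o G)/idfun]_(p <- r) iter (J p.1 p.2) (partial_op M p.1 p.2).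

Definition partialJ J := partialJ_seq J (index_enum ('I_h * 'I_g)%type).

(** [twist *m Z] is the variable [Y] in which the operators have monomial leading terms. *)
Definition twist : 'M[C]_h := (2 * pi_i R) *: map_mx intr M.

Definition twisted_monomial J f : MC -> MC -> C :=
  fun Z W => f W * monomial J (twist *m Z).

Definition leading f J phi := poly_lt entire (mdeg J) (phi - twisted_monomial J f).

Lemma twisted_monomial_poly J f : entire f ->
  poly_lt entire (mdeg J).+1 (twisted_monomial J f).
Proof.
move=> ef.
exact: (poly_lt_substitution twist entire_subspace (poly_lt_monomial ef (ltnSn (mdeg J)))).
Qed.

Lemma leading_step f K k a phi : entire f -> leading f K phi ->
  leading f (incr k a K) (partial_op M k a phi).
Proof.
move=> ef lf; have PS n := poly_lt_subspace n (@entire_subspace R h g).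
rewrite /leading mdeg_incr; set psi := phi - twisted_monomial K f in lf *.
have phin : poly_lt entire (mdeg K).+1 phi.
  have -> : phi = psi + twisted_monomial K f by rewrite /psi subrK.
  apply: (subspaceD (PS _)); last exact: twisted_monomial_poly.
  exact: (poly_ltW (leqnSn _) (@subset_refl _ _) lf).
pose D (u : MC -> MC -> C) : MC -> MC -> C := fun Z W => 'D_(delta_mx k a) (u Z) W.
have Dpsi : poly_lt entire (mdeg K).+1 (D psi).
  exact: (poly_ltW (leqnSn _) (@subset_refl _ _) (poly_lt_derive _ lf)).
have Dphi : poly_lt entire (mdeg K).+1 (D phi) := poly_lt_derive _ phin.
have ppsi := partial_op_poly M k a lf.
(* Multiplication by [Y k a] sends the leading monomial to the next one. What remains is [Y k a]
   times [psi], obtained as [partial_op M k a psi - D psi], plus the derivative of [phi]. *)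
have H := subspaceD (PS _) (subspaceB (PS _) ppsi Dpsi) Dphi.
apply: (eq_ind_r (poly_lt entire (mdeg K).+1) H).
apply/funext => Z; apply/funext => W.
have -> : (partial_op M k a phi - twisted_monomial (incr k a K) f) Z W =
  partial_op M k a phi Z W - twisted_monomial (incr k a K) f Z W by [].
have -> : (partial_op M k a psi - D psi + D phi) Z W =
  partial_op M k a psi Z W - D psi Z W + D phi Z W by [].
have pE u : partial_op M k a u Z W =
  2 * pi_i R * (\sum_l (M k l)%:~R * Z l a) * u Z W + D u Z W by [].
rewrite !pE.
have -> : psi Z W = phi Z W - twisted_monomial K f Z W by [].
rewrite /twisted_monomial monomial_incr.
have -> : (twist *m Z) k a = 2 * pi_i R * (\sum_l (M k l)%:~R * Z l a).
  rewrite /twist -scalemxAl mxE; congr (_ * _); rewrite mxE; apply: eq_bigr => l _.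
  by rewrite mxE.
move: (\sum_l _) (D phi Z W) (D psi Z W) (phi Z W) (f W) (monomial _ _) => *; ring.
Qed.

Lemma leading_iter f K k a m phi : entire f -> leading f K phi ->
  leading f (iter m (incr k a) K) (iter m (partial_op M k a) phi).
Proof.
by move=> ef lf; elim: m => [//|m IH]; rewrite !iterS; exact: leading_step.
Qed.

Lemma leading_partialJ_seq f J r K phi : entire f -> leading f K phi ->
  leading f (foldr (fun p => iter (J p.1 p.2) (incr p.1 p.2)) K r)
    (partialJ_seq J r phi).
Proof.
move=> ef; elim: r K phi => [|p r IH] K phi lf.
  by rewrite /partialJ_seq big_nil.
rewrite /partialJ_seq big_cons /=; apply: leading_iter => //; exact: IH.
Qed.

Lemma iter_incrE m k a K i j :
  iter m (incr k a) K i j = (K i j + m * ((i == k) && (j == a)))%N.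
Proof.
elim: m => [|m IH]; first by rewrite mul0n addn0.
by rewrite iterS mxE IH mulSn -addnA [(_ * _ + _)%N]addnC.
Qed.

Lemma foldr_incrE J r K i j :
  foldr (fun p => iter (J p.1 p.2) (incr p.1 p.2)) K r i j =
  (K i j + J i j * count_mem (i, j) r)%N.
Proof.
elim: r => [|[k a] r IH] /=; first by rewrite muln0 addn0.
rewrite iter_incrE IH -addnA mulnDr; congr (_ + _)%N.
rewrite addnC; congr (_ + _)%N.
rewrite xpair_eqE [k == i]eq_sym [a == j]eq_sym.
by have [->|_] := eqVneq i k; have [->|_] := eqVneq j a; rewrite //= !muln0.
Qed.

Lemma leading_partialJ f J : entire f -> leading f J (partialJ J (Zfree f)).
Proof.
move=> ef.
have l0 : leading f (const_mx 0%N) (Zfree f).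
  rewrite /leading.
  apply: (eq_ind_r (poly_lt entire _) (poly_lt_subspace _ entire_subspace).1).
  apply/funext => Z; apply/funext => W.
  have -> : (Zfree f - twisted_monomial (const_mx 0%N) f) Z W =
     f W - f W * monomial (const_mx 0%N) (twist *m Z) by [].
  by rewrite monomial0 mulr1 subrr.
have := @leading_partialJ_seq f J (index_enum _) _ _ ef l0.
suff -> : foldr (fun p => iter (J p.1 p.2) (incr p.1 p.2)) (const_mx 0%N)
   (index_enum ('I_h * 'I_g)%type) = J by [].
(* Each index pair occurs exactly once in the enumeration, so the accumulated exponent is [J]. *)
apply/matrixP => i j; rewrite foldr_incrE mxE add0n.
by rewrite count_uniq_mem ?index_enum_uniq // mem_index_enum muln1.
Qed.

Variables (Om : 'M[C]_g).
Hypotheses (Msym : M^T = M) (Mpos : posdef (map_mx intr M : 'M[R]_h)).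
Local Notation A := (aux_space Om M : set (MC -> MC -> C)).
Local Notation T := (theta_space Om M : set (MC -> C)).

Lemma iter_partial_op_aux k a m :
  (forall phi, A phi -> A (iter m (partial_op M k a) phi)) /\
  linear_on A (iter m (partial_op M k a)).
Proof.
elim: m => [|m [IA IL]] //; split=> [phi Aphi|c x y Ax Ay].
  by rewrite iterS; apply: partial_op_aux => //; exact: IA.
rewrite !iterS IL // partial_op_linear //; first by case: (IA _ Ax).
by case: (IA _ Ay).
Qed.

Lemma partialJ_seq_aux J r : (forall phi, A phi -> A (partialJ_seq J r phi)) /\
  linear_on A (partialJ_seq J r).
Proof.
elim: r => [|p r [IA IL]]; first by rewrite /partialJ_seq big_nil.
rewrite /partialJ_seq big_cons -/(partialJ_seq J r).
have [pA pL] := iter_partial_op_aux p.1 p.2 (J p.1 p.2).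
split=> [phi Aphi|c x y Ax Ay] /=; first exact/pA/IA.
by rewrite IL // pL //; exact: IA.
Qed.

(** Positive definiteness excludes a real kernel; the determinant commutes with the embedding of [R]
    into [C]. *)
Lemma twist_unit : twist \in unitmx.
Proof.
rewrite unitmxZ; last first.
  rewrite unitfE mulf_neq0 //.
  by apply/eqP => /(congr1 (@complex.Im R)) /= /eqP; rewrite gt_eqF // pi_gt0.
have -> : map_mx intr M = map_mx (real_complex R) (map_mx intr M : 'M[R]_h) :> 'M[C]_h.
  by apply/matrixP => i j; rewrite !mxE rmorph_int.
rewrite unitmxE det_map_mx unitfE fmorph_eq0; apply/negP => /det0P[v v0 vM].
have := Mpos (x := v^T); rewrite trmxK vM mul0mx mxE ltxx => H.
suff : false by []. apply: H.
by apply: contra_neq v0 => /(congr1 trmx); rewrite trmxK trmx0.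
Qed.

Lemma poly_lt_twist n (s : seq MN) (c : MN -> MC -> C) S : subspace S ->
  poly_lt S n (fun Z W => \sum_(J <- s) c J W * monomial J (twist *m Z)) ->
  poly_lt S n (fun Z W => \sum_(J <- s) c J W * monomial J Z).
Proof.
move=> SS /(poly_lt_substitution (invmx twist) SS) H.
apply: (eq_ind_r (poly_lt S n) H); apply/funext => Z; apply/funext => W.
by apply: eq_bigr => J _; rewrite mulmxA mulmxV ?twist_unit // mul1mx.
Qed.

Lemma partialJ_free (s : seq MN) (f : MN -> MC -> C) : uniq s ->
  (forall J, J \in s -> T (f J)) ->
  \sum_(J <- s) partialJ J (Zfree (f J)) = 0 -> forall J, J \in s -> f J = 0.
Proof.
move=> us sT sum0.
have PS n := poly_lt_subspace n (@entire_subspace R h g).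
have AS := @aux_subspace R h g Om M.
(* Descending induction on the degree: once all [f J] of degree above [n] vanish, the relation
   expresses the leading terms of degree [n] by a polynomial of degree less than [n]. *)
have H n : (forall J, J \in s -> (n <= mdeg J)%N -> f J = 0) ->
   forall J, J \in s -> f J = 0.
  elim: n => [|n IH] fn J Js; first exact: fn.
  apply: IH J Js => J Js; rewrite leq_eqVlt => /orP[/eqP nJ|]; last exact: fn.
  pose s' := [seq J <- s | mdeg J == n].
  have Js' : J \in s' by rewrite mem_filter -nJ eqxx.
  apply: (@top_coef_eq0 R h g n s' f) Js'; first exact: filter_uniq.
    by move=> K; rewrite mem_filter => /andP[/eqP].
  apply: poly_lt_twist; first by split.
  apply: (poly_ltW (leqnn n) (@subsetT _ entire)).
  have E : \sum_(K <- s') (twisted_monomial K (f K) - partialJ K (Zfree (f K))) -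
      \sum_(K <- s | mdeg K != n) partialJ K (Zfree (f K)) =
      (fun Z W => \sum_(K <- s') f K W * monomial K (twist *m Z)).
    have sp : \sum_(K <- s') partialJ K (Zfree (f K)) +
        \sum_(K <- s | mdeg K != n) partialJ K (Zfree (f K)) = 0.
      by rewrite /s' big_filter -[RHS]sum0 [RHS](bigID (fun K => mdeg K == n)).
    rewrite sumrB -addrA -opprD sp subr0.
    by apply/funext => Z; apply/funext => W; rewrite !fct_sumE.
  rewrite -E; apply: (subspaceB (PS _)).
    rewrite big_seq; apply: (subspace_sum _ (PS _)) => K.
    rewrite mem_filter => /andP[/eqP Kn Ks].
    rewrite -opprB -scaleN1r; apply: (subspaceZ _ (PS _)).
    have := leading_partialJ K (sT K Ks).1; rewrite /leading Kn; exact.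
  rewrite big_seq_cond; apply: (subspace_sum _ (PS _)) => K /andP[Ks Kn].
  (* Terms of higher degree vanish by hypothesis; those of lower degree stay below [n] together with
     their leading monomials. *)
  have [nK|Kn'] := ltnP n (mdeg K).
    rewrite (fn K Ks nK).
    have z : partialJ K (Zfree 0) = 0 := linear_on0 AS (partialJ_seq_aux K (index_enum _)).2.
    rewrite z; exact: (PS n).1.
  have lK : (mdeg K < n)%N by rewrite ltn_neqAle Kn.
  have -> : partialJ K (Zfree (f K)) =
     (partialJ K (Zfree (f K)) - twisted_monomial K (f K)) + twisted_monomial K (f K).
    by rewrite subrK.
  apply: (subspaceD (PS _)).
    exact: (poly_ltW (ltnW lK) (@subset_refl _ _) (leading_partialJ K (sT K Ks).1)).
  exact: (poly_ltW lK (@subset_refl _ _) (twisted_monomial_poly K (sT K Ks).1)).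
apply: (H (\max_(J <- s) mdeg J).+1) => J Js.
by rewrite ltnNge leq_bigmax_seq.
Qed.

End LeadingTerms.

(** * Spanning: top coefficients are theta functions *)

Section Span.
Context {R : realType} {h g : nat}.
Local Notation C := (Cplx R).
Local Notation MC := 'M[C]_(h, g).
Local Notation MZ := 'M[int]_(h, g).
Local Notation MN := 'M[nat]_(h, g).
Local Notation entire := (@entire R h g).
Implicit Types (phi : MC -> MC -> C) (f : MC -> C).
Variables (Om : 'M[C]_g) (M : 'M[int]_h).
Hypotheses (Msym : M^T = M) (Mpos : posdef (map_mx intr M : 'M[R]_h)).
Local Notation A := (aux_space Om M : set (MC -> MC -> C)).
Local Notation T := (theta_space Om M : set (MC -> C)).
Local Notation L := (@twist R h M).
Local Notation pJ := (@partialJ R h g M).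

Lemma partialJ_aux J phi : A phi -> A (pJ J phi).
Proof. by apply: (partialJ_seq_aux Om Msym J _).1. Qed.

Lemma partialJ_linear J : linear_on A (pJ J).
Proof. exact: (partialJ_seq_aux Om Msym J _).2. Qed.

Lemma partialJ_image_subspace J : subspace (pJ J @` (Zfree @` T)).
Proof.
have Zl : linear_on T Zfree by move=> c x y _ _; exact: Zfree_linear.
apply: (image_subspace (image_subspace (theta_subspace Om M) Zl)).
move=> c _ _ [x Tx <-] [y Ty <-]; apply: partialJ_linear; exact: Zfree_theta.
Qed.

Lemma twist_shift (xi : MZ) (Y : MC) :
  invmx L *m (Y + L *m map_mx intr xi) = invmx L *m Y + map_mx intr xi.
Proof. by rewrite mulmxDr mulmxA mulVmx ?mul1mx // twist_unit. Qed.

Lemma top_coef_theta n (s : seq MN) (c : MN -> MC -> C) phi : A phi -> uniq s ->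
  (forall J, J \in s -> (mdeg J < n.+1)%N) -> (forall J, entire (c J)) ->
  (forall Z W, phi (invmx L *m Z) W = \sum_(J <- s) c J W * monomial J Z) ->
  forall J, J \in s -> mdeg J = n -> T (c J).
Proof.
move=> [_ tphi] us sn ec E J Js Jn; split; first exact: ec.
move=> W0 xi eta.
(* The quasi-periodicity defect of [c K]. In the coordinate [Y] the translation by [xi] is a
   translation by [L xi], so the sum of all [d K W * monomial K Z] is [psi Z W - psi (Z + L xi) W],
   of degree less than [n]; hence the defects of degree [n] vanish. *)
pose d (K : MN) : MC -> C := fun W =>
  c K (W + mulZ xi Om + map_mx intr eta) - theta_factor M Om xi W * c K W.
suff : d J = 0 by move=> /(congr1 (fun u : MC -> C => u W0)) /eqP; rewrite subr_eq0 => /eqP.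
pose s' := [seq K <- s | mdeg K == n].
have Js' : J \in s' by rewrite mem_filter Jn eqxx.
apply: (@top_coef_eq0 R h g n s' d) Js'; first exact: filter_uniq.
  by move=> K; rewrite mem_filter => /andP[/eqP].
have TS : subspace (setT : set (MC -> C)) by split.
have PS m := poly_lt_subspace m TS.
pose psi : MC -> MC -> C := fun Z W =>
  \sum_(K <- s) c K (W + mulZ xi Om + map_mx intr eta) * monomial K Z.
have psin : poly_lt setT n.+1 psi.
  exists [seq (K, fun W => c K (W + mulZ xi Om + map_mx intr eta)) | K <- s].
  split; first by move=> p /mapP[K Ks ->] /=; split=> //; exact: sn.
  by move=> Z W; rewrite big_map.
have sh := poly_lt_shift (L *m map_mx intr xi) TS psin.
pose low : MC -> MC -> C := fun Z W => \sum_(K <- s | mdeg K != n) d K W * monomial K Z.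
have lown : poly_lt setT n low.
  exists [seq (K, d K) | K <- s & mdeg K != n].
  split; last by move=> Z W; rewrite big_map big_filter.
  move=> p /mapP[K]; rewrite mem_filter => /andP[Kn Ks] -> /=; split=> //.
  by rewrite ltn_neqAle Kn -ltnS sn.
have H := subspaceB (PS n) (subspaceZ (-1) (PS n) sh) lown.
apply: (eq_ind_r (poly_lt setT n) H); apply/funext => Z; apply/funext => W.
have -> : (-1 *: (fun Z W => psi (Z + L *m map_mx intr xi) W - psi Z W) - low) Z W
  = -1 * (psi (Z + L *m map_mx intr xi) W - psi Z W) - low Z W by [].
have -> : psi (Z + L *m map_mx intr xi) W =
    theta_factor M Om xi W * \sum_(K <- s) c K W * monomial K Z.
  by rewrite /psi -E twist_shift tphi E.
have sp : \sum_(K <- s) d K W * monomial K Z =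
    \sum_(K <- s') d K W * monomial K Z + low Z W.
  by rewrite /s' big_filter [LHS](bigID (fun K => mdeg K == n)).
have dE : \sum_(K <- s) d K W * monomial K Z =
    psi Z W - theta_factor M Om xi W * \sum_(K <- s) c K W * monomial K Z.
  rewrite /psi mulr_sumr -sumrB; apply: eq_bigr => K _.
  by rewrite /d mulrBl mulrA.
by rewrite mulN1r opprB -dE sp addrK.
Qed.

Lemma partialJ_span phi : A phi ->
  sum_space setT (fun J => pJ J @` (Zfree @` T)) phi.
Proof.
have SS := @sum_space_subspace _ _ _ setT _ (fun J _ => partialJ_image_subspace J).
have PS m := poly_lt_subspace m (@entire_subspace R h g).
have AS := @aux_subspace R h g Om M.
move=> Aphi; have /polynomial_entireP[n pn] := Aphi.1.
elim: n phi Aphi pn => [|n IH] phi Aphi pn; first by rewrite (poly_lt0 pn); exact: SS.1.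
have [s [c [us sn ec E]]] :=
  poly_lt_coef entire_subspace (poly_lt_substitution (invmx L) entire_subspace pn).
have cT J := top_coef_theta Aphi us sn ec E (J := J).
pose s' := [seq K <- s | mdeg K == n].
have s'P K : K \in s' -> mdeg K = n /\ T (c K).
  by rewrite mem_filter => /andP[/eqP Kn Ks]; split=> //; exact: cT.
pose top := \sum_(K <- s') pJ K (Zfree (c K)).
have Atop : A top.
  rewrite /top big_seq; apply: (subspace_sum _ AS) => K /s'P[_ TK].
  by apply: partialJ_aux; exact: Zfree_theta.
have Stop : sum_space setT (fun J => pJ J @` (Zfree @` T)) top.
  rewrite /top big_seq; apply: (subspace_sum _ SS) => K /s'P[_ TK].
  apply: (sub_sum_space (fun J _ => partialJ_image_subspace J) (i := K)) => //.
  by exists (Zfree (c K)) => //; exists (c K).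
have -> : phi = (phi - top) + top by rewrite subrK.
apply: (subspaceD SS _ Stop); apply: IH; first exact: (subspaceB AS).
pose low := \sum_(K <- s | mdeg K != n) twisted_monomial M K (c K).
have lown : poly_lt entire n low.
  rewrite /low big_seq_cond; apply: (subspace_sum _ (PS n)) => K /andP[Ks Kn].
  have lK : (mdeg K < n)%N by rewrite ltn_neqAle Kn -ltnS sn.
  exact: (poly_ltW lK (@subset_refl _ _) (twisted_monomial_poly M K (ec K))).
pose dif := \sum_(K <- s') (pJ K (Zfree (c K)) - twisted_monomial M K (c K)).
have difn : poly_lt entire n dif.
  rewrite /dif big_seq; apply: (subspace_sum _ (PS n)) => K /s'P[Kn _].
  by have := leading_partialJ M K (ec K); rewrite /leading Kn; exact.
have phiE : phi = \sum_(K <- s) twisted_monomial M K (c K).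
  apply/funext => Z; apply/funext => W; rewrite !fct_sumE.
  have := E (L *m Z) W; rewrite mulmxA mulVmx ?twist_unit // mul1mx; exact.
(* Both [phi] and [top] have the same part of degree [n] in [Y]: [low] is the rest of [phi], and
   [dif] the rest of [top]. *)
have -> : phi - top = low - dif.
  rewrite /dif sumrB opprB addrA -/top; congr (_ - _).
  by rewrite phiE (bigID (fun K => mdeg K == n)) /= /s' big_filter addrC.
exact: (subspaceB (PS n) lown difn).
Qed.

End Span.

(** * The decomposition *)

Section Grading.
Context {R : realType} {h g : nat}.
Local Notation C := (Cplx R).
Local Notation MC := 'M[C]_(h, g).
Local Notation MN := 'M[nat]_(h, g).
Implicit Types (phi : MC -> MC -> C) (f : MC -> C) (J : MN) (M N : 'M[int]_h).
Variable (Om : 'M[C]_g).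
Hypotheses (g0 : (0 < g)%N) (Omp : siegel Om).
Local Notation P := (@even_posdef R h).
Local Notation A := (@aux_space R h g Om).
Local Notation T := (@theta_space R h g Om).
Local Notation X := (aux_total Om : set (MC -> MC -> C)).
Local Notation Th := (theta_total Om : set (MC -> C)).
Local Notation pJ := (@partialJ R h g).
Local Notation DJ := (@DeltaJ R h g Om).
Local Notation cmp := (@graded_comp _ _ (MC -> MC -> C) P A).

Let AS M (_ : P M) : subspace (A M) := @aux_subspace R h g Om M.
Let TS M (_ : P M) : subspace (T M) := @theta_subspace R h g Om M.
Let Ai : independent P A := aux_independent g0 Omp.
Let XS : subspace X := sum_space_subspace AS.
Let ThS : subspace Th := sum_space_subspace TS.

Lemma even_posdef_sym M : P M -> M^T = M. Proof. by case. Qed.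

Lemma even_posdef_pos M : P M -> posdef (map_mx intr M : 'M[R]_h). Proof. by case. Qed.

Lemma partial_op0 M k a : partial_op M k a (0 : MC -> MC -> C) = 0.
Proof.
apply: (@linear_on0 _ _ _ (A M) _ (@aux_subspace R h g Om M)).
by move=> c x y [px _] [py _]; exact: partial_op_linear.
Qed.

(** Each [partial_op M k a] preserves its own [aux_space Om M], so the defining sum of [Delta] is
    already a decomposition, and by uniqueness the one chosen by [component]. *)
Lemma DeltaP k a phi : X phi -> X (Delta Om k a phi) /\
  forall M, cmp (Delta Om k a phi) M = partial_op M k a (cmp phi M).
Proof.
move=> Xphi.
have pA M : P M -> forall x, A M x -> A M (partial_op M k a x).
  by move=> PM x Ax; apply: partial_op_aux => //; exact: even_posdef_sym.
have H := graded_op_decomposes AS Ai pA (fun M => partial_op0 M k a) Xphi.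
split; first by exists (fun M => partial_op M k a (cmp phi M)).
by move=> M; rewrite (comp_unique AS Ai H).
Qed.

Lemma Delta_iterP k a m phi : X phi -> X (iter m (Delta Om k a) phi) /\
  forall M, cmp (iter m (Delta Om k a) phi) M = iter m (partial_op M k a) (cmp phi M).
Proof.
move=> Xphi; elim: m => [//|m [IX Ic]]; rewrite iterS.
have [DX Dc] := DeltaP k a IX; split; first exact: DX.
by move=> M; rewrite Dc Ic -iterS.
Qed.

Lemma DeltaJ_seqP J (r : seq ('I_h * 'I_g)) phi : X phi ->
  X ((\big[(fun F G => F \o G)/idfun]_(p <- r) iter (J p.1 p.2) (Delta Om p.1 p.2)) phi) /\
  forall M, cmp ((\big[(fun F G => F \o G)/idfun]_(p <- r)
      iter (J p.1 p.2) (Delta Om p.1 p.2)) phi) M = partialJ_seq M J r (cmp phi M).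
Proof.
elim: r phi => [|p r IH] phi Xphi.
  by rewrite big_nil; split; [exact: Xphi|move=> M; rewrite /partialJ_seq big_nil].
have [IX Ic] := IH _ Xphi; rewrite big_cons /=.
have [DX Dc] := Delta_iterP p.1 p.2 (J p.1 p.2) IX; split; first exact: DX.
by move=> M; rewrite Dc Ic /partialJ_seq big_cons.
Qed.

Lemma DeltaJ_total J phi : X phi -> X (DJ J phi).
Proof. by move=> Xphi; have [DX _] := DeltaJ_seqP J (index_enum _) Xphi; exact: DX. Qed.

Lemma comp_DeltaJ J phi M : X phi -> cmp (DJ J phi) M = pJ M J (cmp phi M).
Proof. by move=> Xphi; have [_ Dc] := DeltaJ_seqP J (index_enum _) Xphi; exact: Dc. Qed.

Lemma DeltaJ_linear J : linear_on X (DJ J).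
Proof.
move=> c x y Xx Xy; have Xcxy := XS.2 c _ _ Xx Xy.
apply: (comp_inj AS Ai) => [||M PM]; first exact: DeltaJ_total.
  by apply: XS.2; exact: DeltaJ_total.
have cl := comp_linear AS Ai M.
rewrite (cl _ _ _ (DeltaJ_total J Xx) (DeltaJ_total J Xy)) !comp_DeltaJ //.
rewrite (cl _ _ _ Xx Xy).
by rewrite (partialJ_linear (Om := Om) (even_posdef_sym PM)) //; exact: (comp_in AS Ai).
Qed.

Lemma DeltaJ_homogeneous J M phi : P M -> A M phi -> DJ J phi = pJ M J phi.
Proof.
move=> PM Aphi; have Xphi : X phi by exact: (sub_sum_space AS PM).
have ApJ : A M (pJ M J phi) by apply: partialJ_aux => //; exact: even_posdef_sym.
apply: (comp_inj AS Ai) => [||N PN]; first exact: DeltaJ_total.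
  exact: (sub_sum_space AS PM).
rewrite comp_DeltaJ //; have [->|NM] := eqVneq N M.
  by rewrite !(comp_homogeneous AS Ai PM).
rewrite !(comp_homogeneous_neq AS Ai PM _ NM) //.
exact: (linear_on0 (AS PN) (partialJ_linear (Om := Om) (even_posdef_sym PN) J)).
Qed.

Lemma decomposes_Zfree f u : decomposes P T f u ->
  decomposes P A (Zfree f) (fun M => Zfree (u M)).
Proof.
move=> /decomposes_ex_seq [s [us sP s0 ->]].
have -> : Zfree (\sum_(M <- s) u M) = \sum_(M <- s) (Zfree (u M) : MC -> MC -> C).
  by apply/funext => Z; apply/funext => W; rewrite /Zfree !fct_sumE.
apply: (decomposes_seq AS) => // [M /sP[PM TM]|M /s0 -> //].
by split=> //; exact: Zfree_theta.
Qed.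

Lemma Zfree_total f : Th f -> X (Zfree f).
Proof. by move=> [u fu]; exists (fun M => Zfree (u M)); exact: decomposes_Zfree. Qed.

Lemma Zfree_image_subspace : subspace (Zfree @` Th : set (MC -> MC -> C)).
Proof. by apply: (image_subspace ThS) => c x y _ _; exact: Zfree_linear. Qed.

Lemma Zfree_theta_subspace M : subspace (Zfree @` T M : set (MC -> MC -> C)).
Proof.
by apply: (image_subspace (@theta_subspace R h g Om M)) => c x y _ _; exact: Zfree_linear.
Qed.

Lemma theta_Zfree_total M phi : P M -> (Zfree @` T M) phi -> X phi.
Proof.
by move=> PM [f Tf <-]; apply: (sub_sum_space AS PM); exact: Zfree_theta.
Qed.

Lemma DeltaJ_total_subspace J : subspace (DJ J @` (Zfree @` Th)).
Proof.
apply: (image_subspace Zfree_image_subspace) => c _ _ [x Tx <-] [y Ty <-].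
by apply: DeltaJ_linear; exact: Zfree_total.
Qed.

Lemma DeltaJ_theta_subspace J M : P M -> subspace (DJ J @` (Zfree @` T M)).
Proof.
move=> PM; apply: (image_subspace (Zfree_theta_subspace M)) => c x y Tx Ty.
by apply: DeltaJ_linear; exact: (theta_Zfree_total PM).
Qed.

(** Taking components at each [M] turns a relation between the images into one between the
    [partialJ] of theta functions for this [M], which [partialJ_free] handles. *)
Lemma DeltaJ_total_independent :
  independent [set: MN] (fun J => DJ J @` (Zfree @` Th)).
Proof.
move=> s u us sP sum0.
have fex (J : MN) : exists f : MC -> C, J \in s -> Th f /\ DJ J (Zfree f) = u J.
  have [Js|_] := boolP (J \in s); last by exists 0.
  by have [_ [_ [f Tf <-] <-]] := sP J Js; exists f.
have [f fP] := choice fex.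
have wex (J : MN) : exists w : 'M[int]_h -> MC -> C, J \in s -> decomposes P T (f J) w.
  have [Js|_] := boolP (J \in s); last by exists (fun _ => 0).
  by have [[w fw] _] := fP J Js; exists w.
have [w wP] := choice wex.
have wE J M : J \in s -> cmp (Zfree (f J)) M = Zfree (w J M).
  by move=> /wP /decomposes_Zfree H; rewrite (comp_unique AS Ai H).
have w0 M : P M -> forall J, J \in s -> w J M = 0.
  move=> PM; apply: (partialJ_free (even_posdef_sym PM) (even_posdef_pos PM)
    (Om := Om) (f := fun J => w J M)) => //.
    by move=> J /wP[+ _ _ _]; exact.
  have cl := comp_linear AS Ai M.
  have Xu J : J \in s -> X (u J).
    by move=> /fP[Tf <-]; apply: DeltaJ_total; exact: Zfree_total.
  have E : \sum_(J <- s) cmp (u J) M = 0.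
    apply: (etrans (esym (linear_on_sum XS cl Xu))).
    by rewrite sum0; exact: (linear_on0 XS cl).
  rewrite -[RHS]E big_seq [RHS]big_seq; apply: eq_bigr => J Js.
  have [Tf <-] := fP J Js.
  by rewrite comp_DeltaJ ?wE //; exact: Zfree_total.
move=> J Js; have [Tf <-] := fP J Js.
have -> : Zfree (f J) = 0 :> (MC -> MC -> C).
  apply: (comp_eq0 AS Ai (Zfree_total Tf)) => M PM.
  by rewrite wE // w0.
exact: (linear_on0 XS (DeltaJ_linear J)).
Qed.

Lemma aux_total_direct_sum :
  direct_sum [set: MN] (fun J => DJ J @` (Zfree @` Th)) X.
Proof.
have VS J (_ : [set: MN] J) := DeltaJ_total_subspace J.
apply: (independent_direct_sum VS DeltaJ_total_independent).
apply/seteqP; split.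
  (* It is enough to reach each [aux_space Om M]; there [DeltaJ] agrees with [partialJ], and
     [partialJ_span] applies. *)
  apply: (sum_space_sub AS (sum_space_subspace VS)) => M PM phi Aphi.
  have pS J (_ : [set: MN] J) := partialJ_image_subspace Om (even_posdef_sym PM) J.
  apply: (sum_space_sub pS (sum_space_subspace VS) _
    (partialJ_span (even_posdef_sym PM) (even_posdef_pos PM) Aphi)).
  move=> J _ _ [_ [f Tf <-] <-]; apply: (sub_sum_space VS (i := J)) => //.
  exists (Zfree f); last by rewrite (DeltaJ_homogeneous J PM) //; exact: Zfree_theta.
  by exists f => //; exact: (sub_sum_space TS PM).
apply: (sum_space_sub VS XS) => J _ _ [_ [f Tf <-] <-].
by apply: DeltaJ_total; exact: Zfree_total.
Qed.

Lemma DeltaJ_direct_sum J :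
  direct_sum P (fun M => DJ J @` (Zfree @` T M)) (DJ J @` (Zfree @` Th)).
Proof.
have VS M (PM : P M) := DeltaJ_theta_subspace J PM.
apply: (independent_direct_sum VS).
  (* [DeltaJ] maps theta functions for [M] into [aux_space Om M], so independence is inherited from
     these spaces. *)
  move=> s u us sP sum0; apply: (Ai us _ sum0) => M Ms.
  have [PM [_ [f Tf <-] <-]] := sP M Ms; split=> //.
  rewrite (DeltaJ_homogeneous J PM) //; last exact: Zfree_theta.
  by apply: partialJ_aux; [exact: even_posdef_sym|exact: Zfree_theta].
apply/seteqP; split.
  move=> _ [_ [f Tf <-] <-]; have [u fu] := Tf.
  have [s [us sP s0 ->]] := decomposes_ex_seq (decomposes_Zfree fu).
  rewrite (linear_on_sum XS (DeltaJ_linear J)); last first.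
    by move=> M /sP[PM AM]; exact: (sub_sum_space AS PM).
  rewrite big_seq; apply: (subspace_sum _ (sum_space_subspace VS)) => M /sP[PM _].
  apply: (sub_sum_space VS PM); exists (Zfree (u M)) => //; exists (u M) => //.
  by case: fu => + _ _ _; exact.
apply: (sum_space_sub VS (DeltaJ_total_subspace J)) => M PM _ [_ [f Tf <-] <-].
exists (Zfree f) => //; exists f => //; exact: (sub_sum_space TS PM).
Qed.

Lemma DeltaJ_isomorphism J M : P M ->
  linear_isomorphism (T M) (DJ J @` (Zfree @` T M)) (fun f => DJ J (Zfree f)).
Proof.
move=> PM; have Zl : linear_on (T M) (fun f => DJ J (Zfree f)).
  move=> c x y Tx Ty; have Xx := theta_Zfree_total PM (ex_intro2 _ _ x Tx erefl).
  have Xy := theta_Zfree_total PM (ex_intro2 _ _ y Ty erefl).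
  exact: (DeltaJ_linear J _ Xx Xy).
split; [exact: TS|exact: DeltaJ_theta_subspace|exact: Zl|split].
- by move=> f Tf; exists (Zfree f); [exists f|].
- move=> x y; rewrite !inE => Tx Ty xy; apply/eqP; rewrite -subr_eq0; apply/eqP.
  have Txy := subspaceB (TS PM) Tx Ty.
  have sT (K : MN) : K \in [:: J] -> T M (x - y) by move=> _; exact: Txy.
  (* Injectivity is the freeness statement for a relation with the single exponent [J]. *)
  apply: (partialJ_free (even_posdef_sym PM) (even_posdef_pos PM)
    (isT : uniq [:: J]) sT _ (mem_head J [::])).
  rewrite big_seq1 -(DeltaJ_homogeneous J PM); last exact: Zfree_theta.
  apply: (etrans (linear_onB (TS PM) Zl Tx Ty)).
  by rewrite xy subrr.
- by move=> _ [_ [f Tf <-] <-]; exists f.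
Qed.

End Grading.

Theorem theorem2 (R : realType) (h g : nat) (Om : 'M[Cplx R]_g) :
  (0 < h)%N -> (0 < g)%N -> siegel Om ->
  [/\ direct_sum [set: 'M[nat]_(h, g)]
        (fun J => DeltaJ Om J @` (Zfree @` theta_total Om))
        (aux_total Om),
      forall J : 'M[nat]_(h, g),
        direct_sum (@even_posdef R h)
          (fun M => DeltaJ Om J @` (Zfree @` theta_space Om M))
          (DeltaJ Om J @` (Zfree @` theta_total Om)) &
      forall (J : 'M[nat]_(h, g)) (M : 'M[int]_h), even_posdef R M ->
        linear_isomorphism (theta_space Om M)
          (DeltaJ Om J @` (Zfree @` theta_space Om M))
          (fun f => DeltaJ Om J (Zfree f))].
Proof.
move=> _ g0 Omp; split.
- exact: aux_total_direct_sum.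
- by move=> J; exact: DeltaJ_direct_sum.
- by move=> J M PM; exact: DeltaJ_isomorphism.
Qed.
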